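(* Let $K\subset\mathbb{R}^2$ be a circle with center $c$ and radius $r>0$. Among all paths (continuous rectifiable curves) in the plane that intersect every tangent line of $K$ there is one of minimal length, and the paths of minimal length are exactly (up to reparametrization) those consisting of a semicircle of $K$ extended at each of its two ends by a segment, of length $r$, of the tangent to $K$ at that end. That is, up to reparametrization and up to a rotation or reflection of the plane that maps $K$ to itself, the shortest path is the one obtained by traversing consecutively the straight segment from $c+(-r,r)$ to $c+(-r,0)$, the semicircle $\{c+r(\cos\theta,\sin\theta):\pi\le\theta\le 2\pi\}$ of $K$ from $c+(-r,0)$ to $c+(r,0)$, and the straight segment from $c+(r,0)$ to $c+(r,r)$.
   Context: A path is a continuous curve $f:[a,b]\to\mathbb{R}^2$ of finite length (rectifiable); no condition is imposed on its starting point or its end point. Paths are considered up to reparametrization (constant stretches being disregarded). A path intersects a line if at least one point $f(t)$ lies on the line. ''Shortest'' means of least length among all paths that intersect all tangent lines of $K$. *)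

(* Defs.v *)
From HB Require Import structures.
From mathcomp Require Import all_boot all_order all_algebra.
From mathcomp Require Import all_classical all_reals all_analysis.

Set Implicit Arguments.
Unset Strict Implicit.
Unset Printing Implicit Defensive.
Import Order.TTheory GRing.Theory Num.Theory.
Import numFieldNormedType.Exports.
Local Open Scope classical_set_scope.
Local Open Scope ring_scope.

Section Plane.
Variable R : realType.
Implicit Types (x y z c o : R * R) (L K : set (R * R)) (r t : R).

(* The norm of MathComp-Analysis on [R * R] is the maximum norm, so it can only
   be used for its topology; all lengths below are Euclidean. *)
Definition edist x y : R :=
  Num.sqrt ((x.1 - y.1) ^+ 2 + (x.2 - y.2) ^+ 2).

Definition circle c r : set (R * R) := [set x | edist x c = r].

Definition line L : Prop :=
  exists x (v : R * R), v != 0 /\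
    L = [set (x.1 + t * v.1, x.2 + t * v.2) | t in [set: R]].

(* Euclid's notion, appropriate for [K] a circle: a line meeting [K] in exactly
   one point. *)
Definition tangent_line K L : Prop := line L /\ exists x, K `&` L = [set x].

Definition rotation o t x : R * R :=
  (o.1 + (cos t * (x.1 - o.1) - sin t * (x.2 - o.2)),
   o.2 + (sin t * (x.1 - o.1) + cos t * (x.2 - o.2))).

(* Reflection across the line through [o] with direction
   [(cos (t / 2), sin (t / 2))]. *)
Definition reflection o t x : R * R :=
  (o.1 + (cos t * (x.1 - o.1) + sin t * (x.2 - o.2)),
   o.2 + (sin t * (x.1 - o.1) - cos t * (x.2 - o.2))).

Definition rotation_or_reflection (s : R * R -> R * R) : Prop :=
  exists o t, s = rotation o t \/ s = reflection o t.

End Plane.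

(* A parametrized curve [[lo, hi] -> R^2]; the values of [curve_fun] outside
   [[lo, hi]] are irrelevant. *)
Record curve (R : realType) := Curve {
  lo : R;
  hi : R;
  curve_fun :> R -> R * R
}.

Section Curves.
Variable R : realType.
Implicit Types (g h : curve R) (L K : set (R * R)) (c : R * R) (r t : R).

(* Analogue of [variation] for plane curves: length of the polygon inscribed in
   [g] with vertices at the parameters [lo g :: s]. *)
Definition polygon_length g (s : seq R) : R :=
  let F := g \o nth (hi g) (lo g :: s) in
  \sum_(0 <= i < size s) edist (F i.+1) (F i).

Definition curve_length g : \bar R :=
  ereal_sup [set (polygon_length g s)%:E | s in itv_partition (lo g) (hi g)].

Definition plane_path g : Prop :=
  [/\ lo g <= hi g,
      {within `[lo g, hi g], continuous g} &
      (curve_length g < +oo)%E].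

Definition meets g L : Prop := exists2 t, t \in `[lo g, hi g] & L (g t).

Definition meets_all_tangents K g : Prop :=
  forall L, tangent_line K L -> meets g L.

Definition shortest_path K g : Prop :=
  [/\ plane_path g,
      meets_all_tangents K g &
      forall h, plane_path h -> meets_all_tangents K h ->
        (curve_length g <= curve_length h)%E].

Definition monotone_change (a b a' b' : R) (u : R -> R) : Prop :=
  [/\ {within `[a, b], continuous u},
      {in `[a, b] &, {homo u : x y / x <= y}},
      u a = a' & u b = b'].

(* The changes of parameter [u] and [v] are onto (intermediate values) but need
   not be injective: two curves are identified when they become equal after
   inserting constant stretches in both. The sense of traversal is preserved. *)
Definition same_up_to_reparametrization g h : Prop :=
  exists a b (u v : R -> R),
    [/\ a <= b,
        monotone_change a b (lo g) (hi g) u,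
        monotone_change a b (lo h) (hi h) v &
        {in `[a, b], forall t, g (u t) = h (v t)}].

Definition transform_curve (s : R * R -> R * R) g : curve R :=
  Curve (lo g) (hi g) (s \o g).

(* Parametrized on [[-1, pi + 1]] with constant speed [r]: down the segment from
   [c + (-r, r)] to [c + (-r, 0)], along the lower semicircle to [c + (r, 0)],
   and up the segment to [c + (r, r)]. *)
Definition u_curve c r : curve R :=
  Curve (-1) (pi + 1) (fun t =>
    if t <= 0 then (c.1 - r, c.2 - r * t)
    else if t <= pi then (c.1 + r * cos (pi + t), c.2 + r * sin (pi + t))
    else (c.1 + r, c.2 + r * (t - pi))).

End Curves.

(* Main.v *)
Require Import Defs.
From mathcomp Require Import all_boot all_order all_algebra.
From mathcomp Require Import all_classical all_reals all_analysis.
From mathcomp Require Import ring lra.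

(** Rescale [K] to the unit circle and write [u th = (cos th, sin th)], so that
    [proj th p] is the scalar product of [p] with [u th].  A connected path meets
    every tangent of the circle exactly when, for each [th], it enters the half
    plane where [proj th] is at least 1.

    Lengths are compared with variations of projections: a polygon is at least as
    long as [sin (h / 2)] times the sum of the variations of its projections in
    the [N] directions [(k + 1 / 2) h], [h = pi / N] ([crofton_chain]); for [N]
    tending to infinity this is the Cauchy-Crofton formula.  Working with finite
    grids replaces integration by finite sums, and the error is only of order
    [h ^ 2].

    A good vertical direction exists ([three_visits]).  Let [E] be the closed set
    of directions in which the path first reaches level 1 and afterwards level
    -1.  Every direction or its opposite lies in [E], so, the circle being
    connected, some direction lies in [E] together with its opposite, and along
    it the path visits level 1, then -1, then 1 again, up to sign.  Call this
    direction vertical, and let [P1] and [P3] be the points of the path at the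
    two outer visits, of height 1 or more.

    The lower bound [2 + pi] ([chain_lower_bound], [arclength_lower_bound]).  Cut
    the path at [P1] and [P3] into a middle part and two tails.  If the middle
    part enters the half plane [proj th <= -1], then its variation in the
    direction [th] is at least [proj th P1 + proj th P3 + 2].  If this happened
    for all [th] in [[0, pi]], averaging would give the heights of [P1] and [P3]
    plus [pi], which is at least [2 + pi].  A half plane that only a tail of
    length [T] enters costs at most [2 T] in this estimate, and requires
    [-1 < proj th P <= T - 1] at the end point [P] of that tail.  The middle part
    always has length 4 or more, so only small [T] matter, and for these the
    directions in question fill an angle less than 1 ([few_shallow_angles]):
    tails cost more than they can save.

    Equality.  When the length is [2 + pi], the tails are trivial, and in every
    direction [th] of [[0, pi]] the variation is at most
    [proj th P1 + proj th P3 + 2] ([total_variation_bound]); for a strict excess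
    in one direction would, at the nearest grid direction, gain a multiple of
    [h], more than the error of order [h ^ 2].  Horizontally this says that the
    abscissa is monotone between -1 and 1; vertically, that the height decreases
    from 1 to -1 and then increases back to 1; in general, that the path stays in
    all the half planes [proj th >= -1].  Since it also has to touch their
    boundaries, it contains the lower semicircle, and these facts leave only the
    U-shaped path ([unit_curve_of_minimal_length]).

    Conversely the U-shaped path has the stated length because its
    parametrization with constant speed [r] is Lipschitz. *)

Set Implicit Arguments.
Unset Strict Implicit.
Unset Printing Implicit Defensive.
Import Order.TTheory GRing.Theory Num.Theory.
Import numFieldNormedType.Exports.
Local Open Scope ring_scope.

(* The bare name would denote a distance with extended real values. *)
Local Notation edist := Defs.edist.

(** * Elementary bounds on sine, cosine and pi *)

Section TrigBounds.
Variable R : realType.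
Implicit Types x y : R.
Local Open Scope classical_set_scope.

(** The Taylor bounds below follow from it one after the other, each being the
    derivative of the next. *)
Lemma ge0_of_derive_ge0 (f df : R -> R) :
  (forall x, is_derive x 1 f (df x)) -> (forall x, 0 <= x -> 0 <= df x) ->
  0 <= f 0 -> forall x, 0 <= x -> 0 <= f x.
Proof.
move=> fd df0 f0 x x0.
have fc : {within `[0, x], continuous f}.
  by apply: derivable_within_continuous => y _; exact: (@ex_derive _ _ _ _ _ _ _ (fd y)).
have [c] := MVT_segment x0 (fun y _ => fd y) fc.
rewrite in_itv /= => /andP[c0 _] e.
have : 0 <= df c * (x - 0) by rewrite mulr_ge0 ?df0 ?subr0.
by lra.
Qed.

Lemma sin_lex x : 0 <= x -> sin x <= x.
Proof.
move=> x0; rewrite -subr_ge0.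
apply: (@ge0_of_derive_ge0 (fun x => x - sin x) (fun x => 1 - cos x)).
- by move=> y _; rewrite subr_ge0 cos_le1.
- by rewrite sin0 subr0.
- by [].
Qed.

Lemma cos_ge_2 x : 0 <= x -> 1 - x ^+ 2 / 2 <= cos x.
Proof.
move=> x0; rewrite -subr_ge0.
apply: (@ge0_of_derive_ge0 (fun x => cos x - (1 - x ^+ 2 / 2))
  (fun x => x - sin x)) => //.
- move=> y; apply: is_derive_eq => /=.
  rewrite /GRing.scale /=; lra.
- by move=> y y0; rewrite subr_ge0 sin_lex.
- by rewrite cos0 expr0n /= mul0r subr0 subrr.
Qed.

Lemma sin_ge_3 x : 0 <= x -> x - x ^+ 3 / 6 <= sin x.
Proof.
move=> x0; rewrite -subr_ge0.
apply: (@ge0_of_derive_ge0 (fun x => sin x - (x - x ^+ 3 / 6))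
  (fun x => cos x - (1 - x ^+ 2 / 2))) => //.
- move=> y; apply: is_derive_eq => /=.
  rewrite /GRing.scale /=; lra.
- by move=> y y0; rewrite subr_ge0 cos_ge_2.
- by rewrite sin0 expr0n /= mul0r subr0 subrr.
Qed.

Lemma cos_le_4 x : 0 <= x -> cos x <= 1 - x ^+ 2 / 2 + x ^+ 4 / 24.
Proof.
move=> x0; rewrite -subr_ge0.
apply: (@ge0_of_derive_ge0 (fun x => (1 - x ^+ 2 / 2 + x ^+ 4 / 24) - cos x)
  (fun x => sin x - (x - x ^+ 3 / 6))) => //.
- move=> y; apply: is_derive_eq => /=.
  rewrite /GRing.scale /=; lra.
- by move=> y y0; rewrite subr_ge0 sin_ge_3.
- by rewrite cos0 !expr0n /= !mul0r subr0 addr0 subrr.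
Qed.

(** The quartic upper bound of the cosine is already negative at [8 / 5]. *)
Lemma pi_lt16_5 : pi < 16%:R / 5%:R :> R.
Proof.
rewrite ltNge; apply/negP => hpi.
have := @cos_le_4 (8 / 5) ltac:(lra).
have : 0 <= cos (8 / 5 : R).
  by apply: cos_ge0_pihalf; apply/andP; split; lra.
lra.
Qed.

Lemma ler_norm_sin x : `|sin x| <= `|x|.
Proof.
wlog x0 : x / 0 <= x => [H|].
  have [/H//|x0] := leP 0 x.
  by have := H (- x); rewrite sinN !normrN; apply; rewrite oppr_ge0 ltW.
rewrite (ger0_norm x0) ler_norml sin_lex // andbT lerNl -sinN.
apply: (@le_trans _ _ `|sin (- x)|); first exact: ler_norm.
rewrite sinN normrN.
have [x1|x1] := leP x 1; last by rewrite (le_trans (sin_max _)) // ltW.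
rewrite ger0_norm ?sin_lex // sin_ge0_pi // x0 /=.
by have := @pi_ge2 R; lra.
Qed.

End TrigBounds.

(** * Polygonal chains and a discrete Cauchy-Crofton inequality *)

Section Chains.
Variable R : realType.
Implicit Types (p q z : R * R) (s t : seq (R * R)) (th : R).

Definition proj th p : R := p.1 * cos th + p.2 * sin th.

Lemma edist_ge0 p q : 0 <= edist p q.
Proof. exact: sqrtr_ge0. Qed.

Lemma edistC p q : edist p q = edist q p.
Proof. by rewrite /edist -[in LHS]sqrrN opprB -[X in _ + X]sqrrN opprB. Qed.

Lemma edistxx p : edist p p = 0.
Proof. by rewrite /edist !subrr expr0n /= addr0 sqrtr0. Qed.

Lemma edist_eq0 p q : edist p q = 0 -> p = q.
Proof.
case: p q => [a b] [c d]; rewrite /edist /= => /eqP.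
rewrite sqrtr_eq0 => le0; congr (_, _); apply/eqP; rewrite -subr_eq0 -sqrf_eq0 eq_le;
by apply/andP; split; [have := sqr_ge0 (a - c); have := sqr_ge0 (b - d); lra | exact: sqr_ge0].
Qed.

(** Cauchy-Schwarz: the two sides differ by the square of [a * f - b * e]. *)
Lemma ler_norm_sqrt_sum (a b e f : R) : e ^+ 2 + f ^+ 2 <= 1 ->
  `|a * e + b * f| <= Num.sqrt (a ^+ 2 + b ^+ 2).
Proof.
move=> ef; rewrite -sqrtr_sqr ler_wsqrtr //.
have : 0 <= (a * f - b * e) ^+ 2 by exact: sqr_ge0.
have : 0 <= (a ^+ 2 + b ^+ 2) * (1 - (e ^+ 2 + f ^+ 2)).
  by rewrite mulr_ge0 ?subr_ge0 // addr_ge0 ?sqr_ge0.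
nra.
Qed.

Lemma projB th p q : proj th p - proj th q =
  (p.1 - q.1) * cos th + (p.2 - q.2) * sin th.
Proof. by rewrite /proj; ring. Qed.

Lemma ler_proj_edist th p q : `|proj th p - proj th q| <= edist p q.
Proof. by rewrite projB ler_norm_sqrt_sum // cos2Dsin2. Qed.

(** Project both summands on the direction from [z] to [p]. *)
Lemma edist_triangle q p z : edist p z <= edist p q + edist q z.
Proof.
set D := edist p z; have [->|D0] := eqVneq D 0; first by rewrite addr_ge0 ?edist_ge0.
have Dp : 0 < D by rewrite lt_def D0 edist_ge0.
set e := (p.1 - z.1) / D; set f := (p.2 - z.2) / D.
have DD : D ^+ 2 = (p.1 - z.1) ^+ 2 + (p.2 - z.2) ^+ 2.
  by rewrite sqr_sqrtr // addr_ge0 ?sqr_ge0.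
have ef : e ^+ 2 + f ^+ 2 <= 1.
  by rewrite /e /f !expr_div_n -mulrDl -DD divff // expf_neq0.
have h1 := le_trans (ler_norm _) (ler_norm_sqrt_sum (p.1 - q.1) (p.2 - q.2) ef).
have h2 := le_trans (ler_norm _) (ler_norm_sqrt_sum (q.1 - z.1) (q.2 - z.2) ef).
apply: le_trans (lerD h1 h2).
have -> : (p.1 - q.1) * e + (p.2 - q.2) * f + ((q.1 - z.1) * e + (q.2 - z.2) * f)
  = (p.1 - z.1) * e + (p.2 - z.2) * f by ring.
suff -> : (p.1 - z.1) * e + (p.2 - z.2) * f = D by [].
apply: (mulIf D0); rewrite -expr2 DD /e /f.
by field.
Qed.

(** Chains are given by a first vertex and the list of the following ones, as
    for [path]. *)
Fixpoint chain_length p s : R :=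
  if s is q :: s' then edist q p + chain_length q s' else 0.

Fixpoint chain_variation th p s : R :=
  if s is q :: s' then `|proj th q - proj th p| + chain_variation th q s' else 0.

Lemma chain_length_cat p s t :
  chain_length p (s ++ t) = chain_length p s + chain_length (last p s) t.
Proof. by elim: s p => [|q s IH] p /=; rewrite ?add0r // IH addrA. Qed.

Lemma chain_variation_cat th p s t :
  chain_variation th p (s ++ t) =
  chain_variation th p s + chain_variation th (last p s) t.
Proof. by elim: s p => [|q s IH] p /=; rewrite ?add0r // IH addrA. Qed.

Lemma chain_length_ge0 p s : 0 <= chain_length p s.
Proof. by elim: s p => //= q s IH p; rewrite addr_ge0 ?edist_ge0. Qed.

Lemma edist_last_le_chain p s : edist (last p s) p <= chain_length p s.
Proof.
elim: s p => [|q s IH] p /=; first by rewrite edistxx.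
by rewrite addrC (le_trans (edist_triangle q _ _)) // lerD2r.
Qed.

Lemma chain_length_mem p s q : q \in p :: s ->
  edist q p + edist (last p s) q <= chain_length p s.
Proof.
rewrite inE => /predU1P[->|/splitPr[s1 s2]]; first by rewrite edistxx add0r edist_last_le_chain.
rewrite -cat_rcons chain_length_cat last_cat last_rcons.
by rewrite lerD ?edist_last_le_chain // -{1}(last_rcons p s1 q) edist_last_le_chain.
Qed.

Lemma proj_last_le_chain th p s :
  `|proj th (last p s) - proj th p| <= chain_variation th p s.
Proof.
elim: s p => [|q s IH] p /=; first by rewrite subrr normr0.
have -> : proj th (last q s) - proj th p =
  (proj th q - proj th p) + (proj th (last q s) - proj th q) by ring.
by rewrite (le_trans (ler_normD _ _)) // lerD2l.
Qed.

Lemma chain_variation_mem th p s q : q \in p :: s ->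
  `|proj th q - proj th p| + `|proj th (last p s) - proj th q|
    <= chain_variation th p s.
Proof.
rewrite inE => /predU1P[->|/splitPr[s1 s2]].
  by rewrite subrr normr0 add0r proj_last_le_chain.
rewrite -cat_rcons chain_variation_cat last_cat last_rcons.
by rewrite lerD ?proj_last_le_chain // -{1}(last_rcons p s1 q) proj_last_le_chain.
Qed.

End Chains.

Section Crofton.
Variables (R : realType) (N : nat).
Hypothesis N0 : (0 < N)%N.

Definition grid_step : R := pi / N%:R.
(** Midpoints of the [N] equal parts of [[0, pi]]: then sums over the grid
    telescope, and the reflection [k -> N - 1 - k] acts as [th -> pi - th]. *)
Definition grid_angle (k : nat) : R := (k%:R + 1 / 2) * grid_step.
Local Notation h := grid_step.
Local Notation S := (sin (grid_step / 2)).

Let N0R : (0 : R) < N%:R. Proof. by rewrite ltr0n. Qed.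

Lemma step_gt0 : 0 < h.
Proof. by rewrite divr_gt0 // pi_gt0. Qed.

Lemma stepN : N%:R * h = pi.
Proof. by rewrite mulrC divfK // gt_eqF. Qed.

Lemma step_le_pi : h <= pi.
Proof. by rewrite ler_pdivrMr // ler_peMr ?pi_ge0 // ler1n. Qed.

Lemma sin_half_step_gt0 : 0 < S.
Proof.
apply: sin_gt0_pi; have := step_gt0; have := step_le_pi; have := @pi_gt0 R.
by move=> *; apply/andP; split; lra.
Qed.

Lemma angle_in (k : 'I_N) : 0 < grid_angle k < pi.
Proof.
have h0 := step_gt0; rewrite /grid_angle; apply/andP; split.
  by apply: mulr_gt0 => //; have := ler0n R k; lra.
rewrite -stepN ltr_pM2r //.
have : (k.+1%:R : R) <= N%:R by rewrite ler_nat.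
by rewrite -natr1; lra.
Qed.

Lemma cos_angle k : 2 * S * cos (grid_angle k) = sin (k.+1%:R * h) - sin (k%:R * h).
Proof.
have -> : k.+1%:R * h = grid_angle k + h / 2 by rewrite /grid_angle -natr1; field.
have -> : k%:R * h = grid_angle k - h / 2 by rewrite /grid_angle; field.
by rewrite sinD sinB; ring.
Qed.

Lemma sin_angle k : 2 * S * sin (grid_angle k) = cos (k%:R * h) - cos (k.+1%:R * h).
Proof.
have -> : k.+1%:R * h = grid_angle k + h / 2 by rewrite /grid_angle -natr1; field.
have -> : k%:R * h = grid_angle k - h / 2 by rewrite /grid_angle; field.
by rewrite cosB cosD; ring.
Qed.

Lemma sum_cos_angle : \sum_(k < N) cos (grid_angle k) = 0 :> R.
Proof.
apply: (@mulfI _ (2 * S)); first by rewrite mulf_neq0 ?gt_eqF ?sin_half_step_gt0.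
rewrite mulr0 mulr_sumr (eq_bigr _ (fun (k : 'I_N) _ => cos_angle k)).
rewrite -(big_mkord xpredT (fun k => sin (k.+1%:R * h) - sin (k%:R * h))).
by rewrite telescope_sumr // stepN mul0r sinpi sin0 subrr.
Qed.

Lemma sum_sin_angle : S * \sum_(k < N) sin (grid_angle k) = 1 :> R.
Proof.
apply: (@mulfI _ 2); first by [].
rewrite mulrA mulr_sumr (eq_bigr _ (fun (k : 'I_N) _ => sin_angle k)).
rewrite -(big_mkord xpredT (fun k => cos (k%:R * h) - cos (k.+1%:R * h))).
under eq_bigr => k _ do rewrite -opprB.
by rewrite sumrN telescope_sumr // stepN mul0r cospi cos0; lra.
Qed.

(** Once the sequence has started to decrease it goes on decreasing, so its
    variation consists of one rise to a maximum [f j] and one descent. *)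
Lemma variation_unimodal (f : nat -> R) n :
  (forall i j, (i <= j)%N -> (j < n)%N -> f i.+1 < f i -> f j.+1 < f j) ->
  exists j, (j <= n)%N /\
    \sum_(k < n) `|f k.+1 - f k| = f j *+ 2 - f 0%N - f n.
Proof.
move=> fn.
suff [[_ ->]|[j [jn ->] _]] :
  ((forall k, (k < n)%N -> f k <= f k.+1) /\
    \sum_(k < n) `|f k.+1 - f k| = f n - f 0%N) \/
  exists2 j, (j <= n)%N /\ \sum_(k < n) `|f k.+1 - f k| = f j *+ 2 - f 0%N - f n &
    exists k, (k < n)%N /\ f k.+1 < f k.
- by exists n; split => //; ring.
- by exists j.
elim: n fn => [|n IH] fn; first by left; rewrite big_ord0 subrr.
have {}IH := IH (fun i j ij jn => fn i j ij (ltnW jn)).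
rewrite big_ord_recr /=.
case: IH => [[ge ->]|[j [jn ->] [k [kn fk]]]].
- have [le|lt] := leP (f n) (f n.+1); [left|right].
    split; last by rewrite ger0_norm ?subr_ge0 //; ring.
    by move=> k; rewrite ltnS leq_eqVlt => /predU1P[->|/ge].
  exists n; last by exists n.
  by split=> //; rewrite ltr0_norm ?subr_lt0 //; ring.
- right; exists j; last by exists k; rewrite ltnW.
  split; first exact: leqW.
  have lt := fn k n (ltnW kn) (ltnSn n) fk.
  by rewrite ltr0_norm ?subr_lt0 //; ring.
Qed.

(** The terms are, up to the factor [2 * sin (h / 2)], the absolute increments of
    [f k = a * sin (k h) - b * cos (k h)].  On [[0, pi]] the factor
    [a * cos + b * sin] has the sign of [a * cot + b], which is monotone; hence
    [f] is unimodal, and its variation is [2 * f j] because [f 0 + f N = 0]. *)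
Lemma crofton_vector (a b : R) :
  S * \sum_(k < N) `|a * cos (grid_angle k) + b * sin (grid_angle k)| <=
  Num.sqrt (a ^+ 2 + b ^+ 2).
Proof.
wlog a0 : a b / 0 <= a => [H|].
  have [/H//|a0] := leP 0 a.
  have := H (- a) (- b) ltac:(by rewrite oppr_ge0 ltW).
  rewrite !sqrrN; under eq_bigr => k _ do rewrite !mulNr -opprD normrN.
  exact.
have S0 := sin_half_step_gt0.
pose f (k : nat) := a * sin (k%:R * h) - b * cos (k%:R * h).
have fS k : f k.+1 - f k = 2 * S * (a * cos (grid_angle k) + b * sin (grid_angle k)).
  have := cos_angle k; have := sin_angle k; rewrite /f => hs hc.
  transitivity (a * (2 * S * cos (grid_angle k)) + b * (2 * S * sin (grid_angle k))).
    by rewrite hs hc; ring.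
  by ring.
have S20 : 0 < 2 * S by rewrite mulr_gt0.
have [i j ij jN|j [_ e]] := @variation_unimodal f N.
  rewrite -subr_lt0 fS pmulr_rlt0 // => lt; rewrite -subr_lt0 fS pmulr_rlt0 //.
  have iN : (i < N)%N by exact: leq_ltn_trans ij jN.
  have /andP[i0 ip] := angle_in (Ordinal iN).
  have /andP[j0 jp] := angle_in (Ordinal jN).
  rewrite /= in i0 ip j0 jp.
  have si := sin_gt0_pi (introT andP (conj i0 ip)).
  have sj := sin_gt0_pi (introT andP (conj j0 jp)).
  have : 0 <= sin (grid_angle j - grid_angle i).
    apply: sin_ge0_pi; rewrite subr_ge0 /grid_angle ler_pM2r ?step_gt0 // lerD2r ler_nat ij /=.
    by rewrite -!/(grid_angle _); lra.
  rewrite sinB => dij.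
  rewrite -(pmulr_rlt0 _ si).
  have : sin (grid_angle j) * (a * cos (grid_angle i) + b * sin (grid_angle i)) < 0.
    by rewrite pmulr_rlt0.
  have := mulr_ge0 a0 dij.
  by lra.
move: e; under eq_bigr => k _ do rewrite fS normrM (gtr0_norm S20).
rewrite -mulr_sumr /f mul0r stepN sin0 cos0 cospi sinpi => e.
have -> : S * \sum_(k < N) `|a * cos (grid_angle k) + b * sin (grid_angle k)| =
  a * sin (j%:R * h) + b * - cos (j%:R * h) by lra.
apply: le_trans (ler_norm _) _; apply: ler_norm_sqrt_sum.
by rewrite sqrrN addrC cos2Dsin2.
Qed.

Lemma crofton_chain p s :
  S * \sum_(k < N) chain_variation (grid_angle k) p s <= chain_length p s.
Proof.
elim: s p => [|q s IH] p /=; first by rewrite big1_eq mulr0.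
rewrite big_split /= mulrDr lerD //.
under eq_bigr => k _ do rewrite projB.
exact: crofton_vector.
Qed.

End Crofton.

(** * The lower bound for chains visiting levels 1, -1, 1 *)

Section Counting.
Variables (R : realType) (N : nat).
Hypothesis N0 : (0 < N)%N.
Local Notation h := (grid_step R N).
Local Notation angle := (grid_angle R N).

(** [#|A|] grid points spread over an angle of at least [(#|A| - 1) h]. *)
Lemma card_ord_diameter (A : {set 'I_N}) (D : R) : 0 <= D ->
  (forall i j : 'I_N, i \in A -> j \in A -> (i <= j)%N -> angle j - angle i <= D) ->
  #|A|%:R * h <= D + h.
Proof.
move=> D0 AD; have h0 := step_gt0 R N0.
have [->|[i0 i0A]] := set_0Vmem A; first by rewrite cards0 mul0r addr_ge0 // ltW.
pose i := [arg min_(i < i0 in A) val i]; pose j := [arg max_(j > i0 in A) val j].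
have [iA imin] : i \in A /\ forall k, k \in A -> (i <= k)%N.
  by rewrite /i; case: (arg_minnP _ i0A) => k kA H; split.
have [jA jmax] : j \in A /\ forall k, k \in A -> (k <= j)%N.
  by rewrite /j; case: (arg_maxnP _ i0A) => k kA H; split.
have ij := imin _ jA.
have card : (#|A| <= (j - i).+1)%N.
  rewrite cardE -(size_map val) -(size_iota i (j - i).+1).
  apply: uniq_leq_size; first by rewrite map_inj_uniq ?enum_uniq //; exact: val_inj.
  move=> m /mapP[k]; rewrite mem_enum => kA ->.
  by rewrite mem_iota imin //= addnS ltnS subnKC // jmax.
have := AD _ _ iA jA ij; rewrite /grid_angle => Dij.
have : #|A|%:R * h <= (j - i).+1%:R * h by rewrite ler_pM2r // ler_nat.
by rewrite -natr1 natrB //; lra.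
Qed.

(** Here [a] and [b] are angles measured from [pi].  Eliminating [x] between the
    two hypotheses bounds [sin (a - b)] by [cos a + 22 / 100], hence by
    [cos (a - b) + 22 / 100], which forces [a - b] to be little more than
    [pi / 4]. *)
Lemma shallow_right (x y a b : R) : 0 <= x -> 1 <= y -> 0 <= b -> b <= a ->
  a <= pi / 2 -> y * sin a - x * cos a <= 22 / 100 -> -1 < y * sin b - x * cos b ->
  a - b <= 97 / 100.
Proof.
move=> x0 y1 b0 ba api ha hb.
have bp : b <= pi / 2 by lra.
have p16 := @pi_lt16_5 R; have p2 := @pi_ge2 R.
have ca : 0 <= cos a by apply: cos_ge0_pihalf; apply/andP; split; lra.
have cb : 0 <= cos b by apply: cos_ge0_pihalf; apply/andP; split; lra.
have cb1 := cos_le1 b.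
have sab : 0 <= sin (a - b) by apply: sin_ge0_pi; apply/andP; split; lra.
have k1 : sin (a - b) <= cos a + 22 / 100.
  have e1 : 0 <= (22 / 100 - (y * sin a - x * cos a)) * cos b.
    by rewrite mulr_ge0 // subr_ge0.
  have e2 : 0 <= (y * sin b - x * cos b + 1) * cos a.
    by rewrite mulr_ge0 //; lra.
  have e3 : 0 <= (y - 1) * sin (a - b) by rewrite mulr_ge0 // subr_ge0.
  move: e3 sab; rewrite sinB => e3 sab.
  nra.
rewrite leNgt; apply/negP => big.
have k2 : cos a <= cos (97 / 100).
  have [l|l] := leP a (97/100); first lra.
  by rewrite ltW // ltr_cos ?in_itv //=; apply/andP; split; lra.
have k3 : sin (97 / 100) <= sin (a - b).
  by rewrite ltW // ltr_sin ?in_itv //=; apply/andP; split; lra.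
have := @sin_ge_3 R (97/100) ltac:(lra).
have := @cos_le_4 R (97/100) ltac:(lra).
lra.
Qed.

Lemma small_of_sin (a c : R) : 0 <= c -> c <= 1 / 2 -> a <= pi / 2 ->
  sin a <= c - c ^+ 3 / 6 -> a <= c.
Proof.
move=> c0 c1 ap sa; rewrite leNgt; apply/negP => ca.
have p2 := @pi_ge2 R.
have : sin c < sin a by rewrite ltr_sin ?in_itv //=; apply/andP; split; lra.
by have := sin_ge_3 c0; lra.
Qed.

(** If [T] is the length of a tail that ends at [(x, y)], this counts the
    directions whose half plane [proj th <= -1] may be reached by the tail but
    not by the middle part, when [T] is at most [122 / 100].  What matters is that they fill an
    angle smaller than 1. *)
Lemma few_shallow_angles (x y : R) : 1 <= y -> h <= 1 / 100 ->
  #|[set k : 'I_N | -1 < x * cos (angle k) + y * sin (angle k) <= 22 / 100]|%:R * h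
    <= 99 / 100.
Proof.
move=> y1 h1; have h0 := step_gt0 R N0.
have p2 := @pi_ge2 R; have p16 := @pi_lt16_5 R.
wlog x0 : x / 0 <= x => [H|].
  (* Reflection in the vertical axis. *)
  have [/H//|x0] := leP 0 x.
  have := H (- x) ltac:(by rewrite oppr_ge0 ltW).
  apply: le_trans; rewrite ler_pM2r // ler_nat.
  set B := [set k | _]; set C := [set k | _].
  rewrite -(card_imset (mem B) (@rev_ord_inj N)); apply: subset_leq_card.
  apply/fintype.subsetP => m /imsetP[k]; rewrite inE => kA ->; rewrite inE.
  suff -> : angle (rev_ord k) = pi - angle k.
    rewrite [cos (pi - _)]cosB [sin (pi - _)]sinB cospi sinpi.
    by move: kA; rewrite !mul0r !addr0 !sub0r !mulN1r mulrNN opprK.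
  rewrite /grid_angle /= natrB ?ltn_ord // -(stepN R N0) -[k.+1%:R]natr1.
  by field.
set A := [set k : 'I_N | _].
pose A1 := [set k in A | angle k < pi / 2]; pose A2 := [set k in A | pi / 2 <= angle k].
have AE : A = A1 :|: A2.
  by apply/finset.setP => k; rewrite !inE; case: (ltP (angle k)); rewrite ?andbT ?andbF ?orbF.
have [i iA1|A10] := pickP (mem A1).
  (* A shallow angle below [pi / 2] is small and forces [x] to be small; then
     the angles on the other side are close to [pi]. *)
  have l1 (k : 'I_N) : k \in A1 -> [/\ 0 <= angle k, angle k <= 25 / 100 & x <= 22 / 100].
    rewrite !inE => /andP[/andP[_ hk] kp]; have /andP[k0 _] := angle_in R N0 k.
    have s0 : 0 <= sin (angle k) by apply: sin_ge0_pi; apply/andP; split; lra.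
    have c0 : 0 < cos (angle k) by apply: cos_gt0_pihalf; apply/andP; split; lra.
    have xc : 0 <= x * cos (angle k) by rewrite mulr_ge0 // ltW.
    have ys : sin (angle k) <= y * sin (angle k) by rewrite ler_peMl.
    split; [exact: ltW | |].
      by apply: small_of_sin; lra.
    have s1 : sin (angle k) < 1 by lra.
    have cs : 1 - sin (angle k) <= cos (angle k).
      have := cos2Dsin2 (angle k); have := cos_le1 (angle k); nra.
    rewrite -(ler_pM2r (ltac:(lra) : 0 < 1 - sin (angle k))).
    have : x * (1 - sin (angle k)) <= x * cos (angle k) by rewrite ler_wpM2l.
    by lra.
  have [_ _ x22] := l1 _ iA1.
  have l2 (k : 'I_N) : k \in A2 -> [/\ angle k <= pi & pi - angle k <= 1 / 2].
    rewrite !inE => /andP[/andP[_ hk] kp]; have /andP[k0 k1] := angle_in R N0 k.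
    have s0 : 0 <= sin (angle k) by apply: sin_ge0_pi; apply/andP; split; lra.
    have ys : sin (angle k) <= y * sin (angle k) by rewrite ler_peMl.
    have xc : - x <= x * cos (angle k).
      by have := mulr_ge0 x0 (ltac:(have := cos_geN1 (angle k); lra) : 0 <= cos (angle k) + 1); lra.
    split; first exact: ltW.
    apply: small_of_sin; [lra|lra|lra|].
    rewrite sinB sinpi cospi; lra.
  have c1 : #|A1|%:R * h <= 25 / 100 + h.
    apply: card_ord_diameter => // j k /l1[? ? _] /l1[? ? _] _; lra.
  have c2 : #|A2|%:R * h <= 1 / 2 + h.
    apply: card_ord_diameter => // j k /l2[? ?] /l2[? ?] _; lra.
  have : #|A|%:R * h <= (#|A1| + #|A2|)%:R * h.
    by rewrite ler_pM2r // ler_nat AE cardsU leq_subr.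
  by rewrite natrD; lra.
have -> : A = A2.
  by rewrite AE; apply/finset.setP => k; rewrite inE; have := A10 k; rewrite inE => ->.
apply: (@le_trans _ _ (97/100 + h)); last lra.
apply: card_ord_diameter => // i j.
rewrite !inE => /andP[/andP[_ hi] ip] /andP[/andP[hj _] jp] ij.
have /andP[_ i1] := angle_in R N0 i; have /andP[_ j1] := angle_in R N0 j.
have aij : angle i <= angle j by rewrite /grid_angle ler_pM2r // lerD2r ler_nat.
have -> : angle j - angle i = (pi - angle i) - (pi - angle j) by ring.
apply: (@shallow_right x y); rewrite ?sinB ?cosB ?sinpi ?cospi; lra.
Qed.

End Counting.

Section LowerBound.
Variables (R : realType) (N : nat).
Hypothesis N0 : (0 < N)%N.
Local Notation h := (grid_step R N).
Local Notation angle := (grid_angle R N).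
Local Notation S := (sin (grid_step R N / 2)).

(** [b] is the middle part, [a] and [c] are the tails.  If only the tail [c]
    reaches the half plane of direction [k], then [-1 < v3 <= T3 - 1] for
    [v3 = proj (angle k) p3], so that the trivial bound [v1 - v3] for the
    variation of [b] falls short of the desired [v1 + v3 + 2] by at most
    [2 * T3]; by [few_shallow_angles] all these losses together, multiplied by
    [S], stay below [99 / 100 * T3].  The same holds for [a]. *)
Lemma chain_lower_bound (p0 p1 p3 : R * R) (a b c : seq (R * R)) :
  h <= 1 / 100 -> last p0 a = p1 -> last p1 b = p3 ->
  1 <= p1.2 -> 1 <= p3.2 -> 4 <= chain_length p1 b ->
  (forall k : 'I_N, exists q, [\/ q \in p0 :: a, q \in p1 :: b | q \in p3 :: c] /\
     proj (angle k) q <= -1) ->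
  2 + 2 * N%:R * S + (chain_length p0 a + chain_length p3 c) / 100 <=
  chain_length p1 b + chain_length p0 a + chain_length p3 c.
Proof.
move=> h1 ap bp y1 y3 M4 cov.
have h0 := step_gt0 R N0; have S0 := sin_half_step_gt0 R N0.
have Sh : 2 * S <= h by have := @sin_lex R (h / 2) ltac:(lra); lra.
have NS : 2 * N%:R * S <= pi.
  by rewrite -(stepN R N0) mulrC mulrA (mulrC S) mulrC ler_wpM2l // ler0n.
have p16 := @pi_lt16_5 R.
set T1 := chain_length p0 a; set T3 := chain_length p3 c.
set M := chain_length p1 b; rewrite -/M in M4.
have T10 : 0 <= T1 by exact: chain_length_ge0.
have T30 : 0 <= T3 by exact: chain_length_ge0.
(* Long tails: [4 + (T1 + T3)] exceeds [2 + pi] since [pi < 16 / 5]. *)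
have [big|small] := leP (122 / 100) (T1 + T3); first lra.
pose A1 := [set k : 'I_N | -1 < p1.1 * cos (angle k) + p1.2 * sin (angle k) <= 22 / 100].
pose A3 := [set k : 'I_N | -1 < p3.1 * cos (angle k) + p3.2 * sin (angle k) <= 22 / 100].
have key (k : 'I_N) : proj (angle k) p1 + proj (angle k) p3 + 2
    - 2 * T1 * (k \in A1)%:R - 2 * T3 * (k \in A3)%:R
    <= chain_variation (angle k) p1 b.
  set v1 := proj _ p1; set v3 := proj _ p3; set V := chain_variation _ _ _.
  have i1 : 0 <= 2 * T1 * (k \in A1)%:R by rewrite mulr_ge0 ?mulr_ge0.
  have i3 : 0 <= 2 * T3 * (k \in A3)%:R by rewrite mulr_ge0 ?mulr_ge0.
  have V13 : `|v3 - v1| <= V by rewrite /V /v3 -bp proj_last_le_chain.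
  have mid q : q \in p1 :: b -> proj (angle k) q <= -1 -> v1 + v3 + 2 <= V.
    move=> /(chain_variation_mem (angle k)); rewrite bp -/v1 -/v3 -/V => hV q1.
    have := ler_norm (v1 - proj (angle k) q); rewrite distrC.
    have := ler_norm (v3 - proj (angle k) q); lra.
  have [l1|l1] := leP v1 (-1).
    by have := mid p1 (mem_head _ _) l1; lra.
  have [l3|l3] := leP v3 (-1).
    by have := mid p3 ltac:(by rewrite -bp mem_last) l3; lra.
  have := ler_norm (v3 - v1); have := ler_norm (v1 - v3); rewrite distrC => n1 n3.
  have [q [[qa|qb|qc] q1]] := cov k.
  - have qT : v1 + 1 <= T1.
      have := chain_length_mem qa; rewrite ap -/T1 => le.
      have := ler_proj_edist (angle k) p1 q; have := edist_ge0 q p0.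
      by have := ler_norm (v1 - proj (angle k) q); rewrite -/v1; lra.
    have -> : k \in A1 by rewrite inE -/(proj (angle k) p1) -/v1 l1 /=; lra.
    by rewrite mulr1; lra.
  - by have := mid q qb q1; lra.
  - have qT : v3 + 1 <= T3.
      have := chain_length_mem qc; rewrite -/T3 => le.
      have := ler_proj_edist (angle k) p3 q; rewrite edistC.
      have := edist_ge0 (last p3 c) q.
      by have := ler_norm (v3 - proj (angle k) q); rewrite -/v3; lra.
    have -> : k \in A3 by rewrite inE -/(proj (angle k) p3) -/v3 l3 /=; lra.
    by rewrite mulr1; lra.
have := crofton_chain N0 p1 b; rewrite -/M => hM.
have : S * \sum_(k < N) (proj (angle k) p1 + proj (angle k) p3 + 2
    - 2 * T1 * (k \in A1)%:R - 2 * T3 * (k \in A3)%:R) <= M.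
  by apply: le_trans hM; rewrite ler_pM2l // ler_sum.
rewrite !sumrB !big_split /= sumr_const card_ord -!mulr_sumr.
have card (A : {set 'I_N}) : \sum_(k < N) ((k \in A)%:R : R) = #|A|%:R.
  by rewrite -sum1_card natr_sum [RHS]big_mkcond /=; apply: eq_bigr => k _; case: (k \in A).
rewrite !card !mulrBr !mulrDr (mulrCA S p1.2) (mulrCA S p3.2) sum_cos_angle //.
rewrite sum_sin_angle // !mulr0 !mulr1 !add0r.
have small_card (A : {set 'I_N}) T : 0 <= T -> #|A|%:R * h <= 99 / 100 ->
    S * (2 * T * #|A|%:R) <= 99 / 100 * T.
  move=> T0 Ah; apply: (@le_trans _ _ (#|A|%:R * h * T)); last by rewrite ler_wpM2r.
  have -> : S * (2 * T * #|A|%:R) = #|A|%:R * (2 * S) * T by ring.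
  by rewrite ler_wpM2r // ler_wpM2l // ler0n.
have := small_card _ _ T10 (few_shallow_angles N0 p1.1 y1 h1).
have := small_card _ _ T30 (few_shallow_angles N0 p3.1 y3 h1).
rewrite -/A1 -/A3 => c3 c1 total; clear - c1 c3 total y1 y3.
move: #|A1| #|A3| c1 c3 total => n1 n3 c1 c3 total; clear A1 A3; lra.
Qed.

End LowerBound.

(** * From chains to curves of bounded length *)

Section Refinement.
Variable R : realType.
Implicit Types (a b L th : R) (G : R -> R * R) (s T : seq R).

Definition chains_bounded G a b L : Prop :=
  forall s, path <=%R a s -> last a s <= b -> chain_length (G a) (map G s) <= L.

(** The times of [s] and [T] in order, closed by the end [b] of the interval. *)
Definition refinement s T b := rcons (sort <=%R (s ++ T)) b.

Lemma path_refinement s T a b : a <= b -> {in s ++ T, forall t, a <= t <= b} ->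
  path <=%R a (refinement s T b).
Proof.
move=> ab ins; rewrite /refinement rcons_path.
have tr : transitive (<=%R : rel R) by exact: le_trans.
have -> : path <=%R a (sort <=%R (s ++ T)).
  rewrite path_sortedE // sort_sorted ?andbT; last exact: le_total.
  by apply/allP => t; rewrite mem_sort => /ins/andP[].
have := mem_last a (sort <=%R (s ++ T)); rewrite inE => /predU1P[->|]//.
by rewrite mem_sort => /ins/andP[].
Qed.

Lemma mem_path_le s a t : path <=%R a s -> t \in a :: s -> a <= t <= last a s.
Proof.
elim: s a t => [|x s IH] a t /=; first by rewrite inE => _ /eqP ->; rewrite lexx.
move=> /andP[ax xs]; rewrite inE => /predU1P[->|/(IH _ _ xs)/andP[xt ->]].
  by rewrite lexx (le_trans ax) //; case/andP: (IH x x xs (mem_head _ _)).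
by rewrite (le_trans ax).
Qed.

Lemma last_refinement s T a b : last a (refinement s T b) = b.
Proof. exact: last_rcons. Qed.

Lemma mem_refinement s T b t : t \in s ++ T -> t \in refinement s T b.
Proof. by rewrite mem_rcons inE mem_sort => ->; rewrite orbT. Qed.

Lemma subseq_refinement s T a b : path <=%R a s -> subseq s (refinement s T b).
Proof.
move=> as_; apply: subseq_trans (subseq_rcons _ _).
rewrite -{1}(sorted_sort (@le_trans _ R) (path_sorted as_)).
apply: subseq_sort; [exact: le_total|exact: le_trans|exact: prefix_subseq].
Qed.

Lemma chain_variation_subseq th (p : R * R) (s t : seq (R * R)) :
  subseq s t -> last p s = last p t ->
  chain_variation th p s <= chain_variation th p t.
Proof.
elim: t p s => [|q t IH] p [|r s] //.
  move=> _ _ /=; rewrite addr_ge0 //.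
  by rewrite (le_trans _ (proj_last_le_chain th q t)).
move=> /= st; case: eqVneq st => [->|rq] st l; first by rewrite lerD2l IH.
have [rt|ql] := boolP (t == [::]); first by rewrite (eqP rt) in st.
have l' : last q (r :: s) = last q t by rewrite /= l; case: (t) ql.
have := IH q (r :: s) st l'; rewrite /= => le.
have -> : proj th r - proj th p = (proj th q - proj th p) + (proj th r - proj th q).
  by ring.
by have := ler_normD (proj th q - proj th p) (proj th r - proj th q); lra.
Qed.

Lemma ler_norm_cosB (x y : R) : `|cos x - cos y| <= `|x - y|.
Proof.
have -> : cos x - cos y = - 2 * sin ((x + y) / 2) * sin ((x - y) / 2).
  have -> : cos x = cos ((x + y) / 2 + (x - y) / 2) by congr cos; field.
  have -> : cos y = cos ((x + y) / 2 - (x - y) / 2) by congr cos; field.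
  by rewrite cosD cosB; ring.
rewrite !normrM normrN (ger0_norm (ltac:(lra) : 0 <= 2 :> R)).
have := ler_norm_sin ((x - y) / 2); rewrite [X in _ <= X]normrM.
rewrite (ger0_norm (ltac:(lra) : 0 <= 2^-1 :> R)) => le1.
have : `|sin ((x + y) / 2)| * `|sin ((x - y) / 2)| <= 1 * `|sin ((x - y) / 2)|.
  by rewrite ler_wpM2r // sin_max.
lra.
Qed.

Lemma ler_norm_sinB (x y : R) : `|sin x - sin y| <= `|x - y|.
Proof.
rewrite -!cosBpihalf (le_trans (ler_norm_cosB _ _)) //.
by rewrite opprB addrA subrK.
Qed.

Lemma ler_norm_proj th th' (p : R * R) :
  `|proj th p - proj th' p| <= (`|p.1| + `|p.2|) * `|th - th'|.
Proof.
have -> : proj th p - proj th' p = p.1 * (cos th - cos th') + p.2 * (sin th - sin th').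
  by rewrite /proj; ring.
apply: le_trans (ler_normD _ _) _; rewrite !normrM mulrDl.
by rewrite lerD // ler_wpM2l // ?ler_norm_cosB ?ler_norm_sinB.
Qed.

Lemma proj_sub th (p q : R * R) :
  proj th (p.1 - q.1, p.2 - q.2) = proj th p - proj th q.
Proof. by rewrite projB. Qed.

(** An increment [d] changes by at most [2 * |d| * |th - th'|] when the direction
    turns from [th'] to [th]. *)
Lemma chain_variation_angle th th' (p : R * R) (s : seq (R * R)) :
  chain_variation th p s <=
  chain_variation th' p s + 2 * chain_length p s * `|th - th'|.
Proof.
elim: s p => [|q s IH] p /=; first by rewrite mulr0 mul0r addr0.
have := IH q; rewrite -!proj_sub; set d := (_, _).
have d1 : `|d.1| <= edist q p.
  have := @ler_norm_sqrt_sum R d.1 d.2 1 0; rewrite mulr1 mulr0 addr0; apply.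
  by rewrite expr1n expr0n addr0.
have d2 : `|d.2| <= edist q p.
  have := @ler_norm_sqrt_sum R d.1 d.2 0 1; rewrite mulr1 mulr0 add0r; apply.
  by rewrite expr1n expr0n add0r.
have := ler_norm_proj th th' d.
have : (`|d.1| + `|d.2|) * `|th - th'| <= 2 * edist q p * `|th - th'|.
  by rewrite ler_wpM2r //; lra.
have := ler_normD (proj th d - proj th' d) (proj th' d); rewrite subrK; lra.
Qed.

Lemma snd_le_edist (p q : R * R) : p.2 - q.2 <= edist p q.
Proof.
have := ler_proj_edist (pi / 2) p q; rewrite projB cos_pihalf sin_pihalf.
by rewrite mulr0 mulr1 add0r; apply: le_trans; exact: ler_norm.
Qed.

(** The times [r1] and [r3] are arbitrary in the tails: if the bound is attained,
    the curve must be constant there. *)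
Lemma arclength_lower_bound_step N G a b L t1 t2 t3 r1 r3 : (0 < N)%N ->
  grid_step R N <= 1 / 100 -> chains_bounded G a b L ->
  [/\ a <= r1 & r1 <= t1] -> [/\ t1 <= t2 & t2 <= t3] -> [/\ t3 <= r3 & r3 <= b] ->
  [/\ 1 <= (G t1).2, (G t2).2 <= -1 & 1 <= (G t3).2] ->
  (forall th, exists2 t, a <= t <= b & proj th (G t) <= -1) ->
  2 + 2 * N%:R * sin (grid_step R N / 2) + (edist (G r1) (G t1) + edist (G r3) (G t3)) / 100 <= L.
Proof.
move=> N0 h1 Lb [ar1 r1t1] [t12 t23] [t3r3 r3b] [y1 y2 y3] cov.
pose tau k := s2val (cid2 (cov (grid_angle R N k))).
have tauin k : a <= tau k <= b by rewrite /tau; case: cid2.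
have tauP k : proj (grid_angle R N k) (G (tau k)) <= -1 by rewrite /tau; case: cid2.
pose T := [seq tau k | k <- iota 0 N].
pose sel u v r := refinement [::] (r :: [seq t <- T | u <= t <= v]) v.
have selP u v r : u <= r <= v -> path <=%R u (sel u v r).
  move=> urv; apply: path_refinement; first by case/andP: urv; exact: le_trans.
  by move=> t; rewrite inE mem_filter => /predU1P[->//|/andP[]].
have sell u v r : last u (sel u v r) = v by exact: last_refinement.
have selr u v r : r \in sel u v r by rewrite mem_refinement // mem_head.
have selT u v r k : (k < N)%N -> u <= tau k <= v -> tau k \in sel u v r.
  move=> kN uv; rewrite mem_refinement // inE mem_filter uv map_f ?orbT //.
  by rewrite mem_iota.
have p1 : path <=%R a (sel a t1 r1) by apply: selP; rewrite ar1.
have p2 : path <=%R t1 (sel t1 t3 t2) by apply: selP; rewrite t12.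
have p3 : path <=%R t3 (sel t3 b r3) by apply: selP; rewrite t3r3.
have mG u s t : t \in u :: s -> G t \in G u :: map G s.
  by rewrite -map_cons; exact: map_f.
have M4 : 4 <= chain_length (G t1) (map G (sel t1 t3 t2)).
  have := @chain_length_mem R (G t1) (map G (sel t1 t3 t2)) (G t2).
  rewrite mG ?inE ?selr ?orbT // last_map sell => /(_ isT).
  by have := snd_le_edist (G t1) (G t2); have := snd_le_edist (G t3) (G t2);
    rewrite (edistC (G t1)); lra.
have covk (k : 'I_N) : exists q, [\/ q \in G a :: map G (sel a t1 r1),
    q \in G t1 :: map G (sel t1 t3 t2) | q \in G t3 :: map G (sel t3 b r3)] /\
    proj (grid_angle R N k) q <= -1.
  exists (G (tau k)); split; last exact: tauP.
  have /andP[at_ tb] := tauin k.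
  have [l1|l1] := leP (tau k) t1.
    by apply: Or31; apply: mG; rewrite inE selT ?orbT // at_.
  have [l3|l3] := leP (tau k) t3.
    by apply: Or32; apply: mG; rewrite inE selT ?orbT // l3 ltW.
  by apply: Or33; apply: mG; rewrite inE selT ?orbT // tb ltW.
have := chain_lower_bound N0 (p0 := G a) (a := map G (sel a t1 r1))
  (p1 := G t1) (b := map G (sel t1 t3 t2)) (p3 := G t3) (c := map G (sel t3 b r3)) h1.
rewrite !last_map !sell => /(_ erefl erefl y1 y3 M4 covk).
set T1 := chain_length (G a) _; set T3 := chain_length (G t3) _ => le.
have L1 : edist (G r1) (G t1) <= T1.
  have := @chain_length_mem R (G a) (map G (sel a t1 r1)) (G r1).
  rewrite mG ?inE ?selr ?orbT // last_map sell => /(_ isT).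
  by rewrite (edistC (G t1)) -/T1; have := edist_ge0 (G r1) (G a); lra.
have L3 : edist (G r3) (G t3) <= T3.
  have := @chain_length_mem R (G t3) (map G (sel t3 b r3)) (G r3).
  rewrite mG ?inE ?selr ?orbT // last_map sell => /(_ isT).
  by rewrite -/T3; have := edist_ge0 (G b) (G r3); lra.
have := Lb (sel a t1 r1 ++ sel t1 t3 t2 ++ sel t3 b r3).
rewrite !cat_path !last_cat !sell p1 p2 p3 !map_cat !chain_length_cat !last_map !sell.
move=> /(_ isT (lexx _)); rewrite -/T1 -/T3; lra.
Qed.

Lemma step_lt (e : R) : 0 < e -> exists N, (0 < N)%N /\ grid_step R N < e.
Proof.
move=> e0; exists (Num.truncn (pi / e)).+1; split=> //.
rewrite /grid_step ltr_pdivrMr ?ltr0n // mulrC -ltr_pdivrMr //.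
by have := truncnS_gt (pi / e).
Qed.

(** The grid loses only order [h ^ 2] in the limit [pi], whereas the weight
    [sin (h / 2)] of a single direction is of order [h]. *)
Lemma half_step_sin N : (0 < N)%N -> grid_step R N <= 1 ->
  pi - grid_step R N ^+ 2 <= 2 * N%:R * sin (grid_step R N / 2) /\
  grid_step R N / 4 <= sin (grid_step R N / 2).
Proof.
move=> N0 h1; have h0 := step_gt0 R N0; have Nh := stepN R N0.
have p16 := @pi_lt16_5 R; have p0 := @pi_gt0 R.
have := @sin_ge_3 R (grid_step R N / 2) ltac:(lra).
set h := grid_step R N in h0 h1 Nh *; set S := sin _ => Sh.
have h2 : h ^+ 2 <= 1 by rewrite expr2; nra.
split; last by nra.
have : 2 * N%:R * (h / 2 - (h / 2) ^+ 3 / 6) <= 2 * N%:R * S.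
  by rewrite ler_wpM2l // mulr_ge0 // ler0n.
apply: le_trans.
have -> : 2 * N%:R * (h / 2 - (h / 2) ^+ 3 / 6) = N%:R * h - (N%:R * h) * h ^+ 2 / 24 by field.
rewrite Nh; have : 0 <= h ^+ 2 by exact: sqr_ge0.
by nra.
Qed.

Lemma arclength_lower_bound G a b L t1 t2 t3 r1 r3 : chains_bounded G a b L ->
  [/\ a <= r1 & r1 <= t1] -> [/\ t1 <= t2 & t2 <= t3] -> [/\ t3 <= r3 & r3 <= b] ->
  [/\ 1 <= (G t1).2, (G t2).2 <= -1 & 1 <= (G t3).2] ->
  (forall th, exists2 t, a <= t <= b & proj th (G t) <= -1) ->
  2 + pi + (edist (G r1) (G t1) + edist (G r3) (G t3)) / 100 <= L.
Proof.
move=> Lb H1 H2 H3 H4 cov; rewrite leNgt; apply/negP; set E := (X in X / 100).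
rewrite -subr_gt0; set e := _ - L => e0.
have [N [N0 hN]] := step_lt (ltac:(rewrite lt_min e0; lra) : 0 < Num.min e (1 / 100)).
move: hN; rewrite lt_min => /andP[he h1].
have := arclength_lower_bound_step N0 (ltW h1) Lb H1 H2 H3 H4 cov; rewrite -/E.
have [] := half_step_sin N0 (ltac:(lra) : grid_step R N <= 1).
have h0 := step_gt0 R N0.
have : grid_step R N ^+ 2 <= grid_step R N by rewrite expr2 ler_piMl ?ltW //; lra.
rewrite /e in he; lra.
Qed.

Lemma angle_near N th : (0 < N)%N -> 0 <= th <= pi ->
  exists k : 'I_N, `|grid_angle R N k - th| <= grid_step R N.
Proof.
move=> N0 /andP[th0 thpi]; have h0 := step_gt0 R N0; have Nh := stepN R N0.
have q0 : 0 <= th / grid_step R N by rewrite divr_ge0 // ltW.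
have [l|l] := ltP th pi.
  have kN : (Num.truncn (th / grid_step R N) < N)%N.
    by rewrite truncn_lt_nat // ltr_pdivrMr // Nh.
  exists (Ordinal kN); rewrite /grid_angle /=.
  have := truncn_itv q0.
  rewrite ler_pdivlMr //  ltr_pdivrMr // -natr1 => /andP[]; set t := _%:R => l1 l2.
  by rewrite ler_norml; apply/andP; split; lra.
have kN : (N.-1 < N)%N by rewrite prednK.
exists (Ordinal kN); rewrite /grid_angle /= ler_norml.
have : N%:R = N.-1%:R + 1 :> R by rewrite natr1 prednK.
by move=> e; rewrite e in Nh; apply/andP; split; lra.
Qed.

(** An excess of the variation in the direction [th] survives at the nearest
    grid direction [k0], up to a multiple of the grid step, and there contributes with the weight
    [sin (h / 2)].  The chain used has to refine [s] and to reach all the half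
    planes of the grid. *)
Lemma total_variation_step N G a b L th s : (0 < N)%N -> a <= b ->
  chains_bounded G a b L ->
  (forall th, exists2 t, a <= t <= b & proj th (G t) <= -1) ->
  0 <= th <= pi -> path <=%R a s -> last a s = b ->
  (G a).2 + (G b).2 + 2 * N%:R * sin (grid_step R N / 2) +
  sin (grid_step R N / 2) * (chain_variation th (G a) (map G s)
     - (proj th (G a) + proj th (G b) + 2) -
     (`|(G a).1| + `|(G a).2| + (`|(G b).1| + `|(G b).2|) + 2 * L) * grid_step R N) <= L.
Proof.
move=> N0 ab Lb cov th0 ps ls; set C := _ + 2 * L.
have h0 := step_gt0 R N0; have S0 := sin_half_step_gt0 R N0.
pose tau k := s2val (cid2 (cov (grid_angle R N k))).
have tauin k : a <= tau k <= b by rewrite /tau; case: cid2.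
have tauP k : proj (grid_angle R N k) (G (tau k)) <= -1 by rewrite /tau; case: cid2.
pose T := [seq tau k | k <- iota 0 N].
pose u := refinement s T b.
have pu : path <=%R a u.
  apply: path_refinement => // t; rewrite mem_cat => /orP[ts|/mapP[k _ ->//]].
  by have := mem_path_le ps; rewrite ls; apply; rewrite inE ts orbT.
have lu : last a u = b by exact: last_refinement.
have hL : chain_length (G a) (map G u) <= L by apply: Lb => //; rewrite lu.
have := crofton_chain N0 (G a) (map G u) => /le_trans/(_ hL).
have [k0 k0th] := angle_near N0 th0.
set p := G a; set q := G b; set V := chain_variation th _ _.
set g := V - _ - _.
have key (k : 'I_N) : proj (grid_angle R N k) p + proj (grid_angle R N k) q + 2 + g * (k == k0)%:R
    <= chain_variation (grid_angle R N k) p (map G u).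
  have [->|_] := eqVneq k k0; last first.
    rewrite mulr0 addr0.
    have := @chain_variation_mem R (grid_angle R N k) p (map G u) (G (tau k)).
    have tu : tau k \in a :: u.
      rewrite inE [_ \in u]mem_refinement ?orbT // mem_cat.
      by rewrite [_ \in T]map_f ?orbT // mem_iota ltn_ord.
    rewrite last_map lu -/q -map_cons map_f // => /(_ isT); have := tauP k.
    have := ler_norm (proj (grid_angle R N k) p - proj (grid_angle R N k) (G (tau k))).
    have := ler_norm (proj (grid_angle R N k) q - proj (grid_angle R N k) (G (tau k))).
    by rewrite (distrC (proj _ p)); lra.
  rewrite mulr1.
  have v1 : chain_variation (grid_angle R N k0) p (map G s) <=
      chain_variation (grid_angle R N k0) p (map G u).
    apply: chain_variation_subseq; last by rewrite !last_map ls lu.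
    by apply: map_subseq; exact: subseq_refinement ps.
  have := chain_variation_angle th (grid_angle R N k0) p (map G s); rewrite -/V.
  have := ler_norm_proj (grid_angle R N k0) th p; have := ler_norm_proj (grid_angle R N k0) th q.
  have sL : chain_length p (map G s) <= L by apply: Lb; rewrite ?ls.
  have s0 := chain_length_ge0 p (map G s).
  rewrite (distrC th); set d := `|grid_angle R N k0 - th| in k0th *.
  have d0 : 0 <= d by exact: normr_ge0.
  have := ler_norm (proj (grid_angle R N k0) p - proj th p).
  have := ler_norm (proj (grid_angle R N k0) q - proj th q).
  have c1 : chain_length p (map G s) * d <= L * grid_step R N.
    by apply: ler_pM.
  have c2 : (`|p.1| + `|p.2|) * d <= (`|p.1| + `|p.2|) * grid_step R N by rewrite ler_wpM2l // addr_ge0.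
  have c3 : (`|q.1| + `|q.2|) * d <= (`|q.1| + `|q.2|) * grid_step R N by rewrite ler_wpM2l // addr_ge0.
  rewrite /g /C -/p -/q; lra.
move=> hM; apply: le_trans hM.
have : sin (grid_step R N / 2) * \sum_(k < N) (proj (grid_angle R N k) p + proj (grid_angle R N k) q + 2 +
     g * (k == k0)%:R) <= sin (grid_step R N / 2) *
     \sum_(k < N) chain_variation (grid_angle R N k) p (map G u).
  by rewrite ler_pM2l // ler_sum.
apply: le_trans.
rewrite !big_split /= sumr_const card_ord -!mulr_sumr.
have one : \sum_(k < N) ((k == k0)%:R : R) = 1.
  by rewrite (bigD1 k0) //= eqxx big1 ?addr0 // => k /negPf ->.
rewrite one.
rewrite !mulrDr (mulrCA _ p.2) (mulrCA _ q.2) sum_cos_angle //.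
rewrite sum_sin_angle // !mulr0 !mulr1 !add0r /g; lra.
Qed.

(** Otherwise the contribution of order [h] in [total_variation_step] would
    outweigh the error of order [h ^ 2] for a fine grid. *)
Lemma total_variation_bound G a b th s : a <= b ->
  chains_bounded G a b (2 + pi) -> 1 <= (G a).2 -> 1 <= (G b).2 ->
  (forall th, exists2 t, a <= t <= b & proj th (G t) <= -1) ->
  0 <= th <= pi -> path <=%R a s -> last a s = b ->
  chain_variation th (G a) (map G s) <= proj th (G a) + proj th (G b) + 2.
Proof.
move=> ab Lb ya yb cov th0 ps ls.
pose C := `|(G a).1| + `|(G a).2| + (`|(G b).1| + `|(G b).2|) + 2 * (2 + pi).
set V := chain_variation _ _ _; set P := _ + 2.
have step0 N (N0 : (0 < N)%N) : (G a).2 + (G b).2 + 2 * N%:R * sin (grid_step R N / 2) +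
    sin (grid_step R N / 2) * (V - P - C * grid_step R N) <= 2 + pi.
  exact: total_variation_step N0 ab Lb cov th0 ps ls.
rewrite leNgt -subr_gt0; apply/negP => e0.
have C0 : 0 < C.
  by have := @pi_gt0 R; rewrite /C; have := normr_ge0 (G a).1; have := normr_ge0 (G a).2;
   have := normr_ge0 (G b).1; have := normr_ge0 (G b).2; lra.
have [N [N0 hN]] := step_lt (ltac:(rewrite !lt_min; apply/andP; split;
  [lra|apply: divr_gt0; lra]) : 0 < Num.min 1 ((V - P) / (C + 4))).
move: hN; rewrite lt_min ltr_pdivlMr; last lra.
move=> /andP[h1 hC]; have h0 := step_gt0 R N0.
have [c1 c2] := half_step_sin N0 (ltW h1).
have := step0 N N0.
have k1 : grid_step R N * 4 <= V - P - C * grid_step R N by lra.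
have k2 : grid_step R N / 4 * (grid_step R N * 4) <= sin (grid_step R N / 2) * (V - P - C * grid_step R N).
  by apply: ler_pM => //; lra.
have : grid_step R N / 4 * (grid_step R N * 4) = grid_step R N ^+ 2 by field.
have [e|ne] := eqVneq (grid_step R N ^+ 2) 0.
  by move/eqP: e; rewrite sqrf_eq0 gt_eqF.
move=> k3 k4.
suff : grid_step R N / 4 * (grid_step R N * 4) < sin (grid_step R N / 2) * (V - P - C * grid_step R N).
  by lra.
apply: lt_le_trans (ler_wpM2r _ c2); last lra.
by rewrite ltr_pM2l; lra.
Qed.

End Refinement.

(** * Curves with minimal variation in all upward directions *)

Section UnitExtremal.
Variable R : realType.
Implicit Types (a b th t : R) (G : R -> R * R).
Local Open Scope classical_set_scope.

Definition unit_path t : R * R :=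
  if t <= 0 then (-1, - t)
  else if t <= pi then (- cos t, - sin t) else (1, t - pi).

(** The inverse on the image of [unit_path]: on the left segment the first summand
    is 0, on the arc the second one is 0, on the right segment the first one is
    [pi].  One formula for the three pieces makes continuity evident. *)
Definition unit_path_inv (p : R * R) : R := acos (- p.1) + p.1 * Num.max p.2 0.

Lemma unit_path_invK_left y : 0 <= y -> unit_path (unit_path_inv (-1, y)) = (-1, y).
Proof.
move=> y0; rewrite /unit_path_inv /= opprK acos1 add0r (max_idPl y0) mulN1r.
by rewrite /unit_path oppr_le0 y0 opprK.
Qed.

Lemma unit_path_invK_arc x : -1 < x < 1 ->
  unit_path (unit_path_inv (x, - Num.sqrt (1 - x ^+ 2))) = (x, - Num.sqrt (1 - x ^+ 2)).
Proof.
move=> /andP[x1 x2].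
have xi : -1 <= - x <= 1 by apply/andP; split; lra.
rewrite /unit_path_inv /= (max_idPr _) ?oppr_le0 ?sqrtr_ge0 // mulr0 addr0 /unit_path.
rewrite leNgt acos_gt0 ?acos_lepi //=; last by apply/andP; split; lra.
by rewrite acosK ?in_itv //= opprK sin_acos // sqrrN.
Qed.

Lemma unit_path_invK_right y : 0 <= y -> unit_path (unit_path_inv (1, y)) = (1, y).
Proof.
move=> y0; have p0 := @pi_gt0 R.
rewrite /unit_path_inv /= acosN1 (max_idPl y0) mul1r /unit_path.
rewrite leNgt ltr_wpDr //=; case: ifPn => [l|_]; last by rewrite addrC addKr.
have -> : y = 0 by apply/eqP; rewrite eq_le y0 andbT; lra.
by rewrite addr0 cospi sinpi opprK oppr0.
Qed.

(** The points of the strip of width 2 that lie on or above the lower semicircle. *)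
Definition above_half_disk (p : R * R) : Prop :=
  forall th, 0 <= th <= pi -> -1 <= proj th p.

Lemma above_half_disk_x p : above_half_disk p -> -1 <= p.1 <= 1.
Proof.
move=> H; have p0 := @pi_ge0 R.
have := H 0 ltac:(by rewrite lexx p0); have := H pi ltac:(by rewrite lexx p0).
by rewrite /proj cos0 sin0 cospi sinpi => *; apply/andP; split; lra.
Qed.

(** Apply the hypothesis in the direction opposite to [p], which points upwards. *)
Lemma above_half_disk_norm p : above_half_disk p -> p.2 < 0 ->
  p.1 ^+ 2 + p.2 ^+ 2 <= 1.
Proof.
case: p => x y H /= y0; set n2 := _ + _; pose n := Num.sqrt n2.
have n20 : 0 < n2 by rewrite ltr_wpDl ?sqr_ge0 // expr2 nmulr_rgt0.
have n0 : 0 < n by rewrite sqrtr_gt0.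
have nE : n ^+ 2 = n2 by rewrite sqr_sqrtr // ltW.
have xn : -1 <= - (x / n) <= 1.
  have : `|x / n| <= 1.
    rewrite normrM normfV (gtr0_norm n0) ler_pdivrMr // mul1r.
    rewrite -(@ler_pXn2r _ 2) ?nnegrE ?normr_ge0 ?(ltW n0) // nE real_normK ?num_real //.
    by rewrite lerDl sqr_ge0.
  by rewrite -normrN ler_norml.
have := H (acos (- (x / n))) ltac:(by rewrite acos_ge0 // acos_lepi).
rewrite /proj /= acosK ?in_itv //= sin_acos // sqrrN.
have -> : 1 - (x / n) ^+ 2 = (- y / n) ^+ 2.
  apply: (@mulIf _ (n ^+ 2)); first by rewrite expf_neq0 // gt_eqF.
  rewrite mulrBl !expr_div_n sqrrN !divfK ?expf_neq0 ?gt_eqF // mul1r nE /n2; ring.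
have yn0 : 0 <= - y / n by rewrite divr_ge0 ?oppr_ge0 // ltW.
rewrite sqrtr_sqr ger0_norm //.
have -> : x * - (x / n) + y * (- y / n) = - n.
  apply: (@mulIf _ n); first by rewrite gt_eqF.
  rewrite [RHS]mulNr -expr2 nE /n2.
  by field; rewrite gt_eqF.
by move=> n1; rewrite -nE expr2; nra.
Qed.

(** By [above_half_disk_norm] the point lies in the unit disk, where [- u th] is the only
    point with [proj th = -1]. *)
Lemma above_half_disk_contact p th : above_half_disk p -> 0 < th < pi ->
  proj th p <= -1 -> p = (- cos th, - sin th).
Proof.
case: p => x y H /andP[t0 tp] c.
have [x1 x2] := andP (above_half_disk_x H); rewrite /= in x1 x2.
have c2 := cos2Dsin2 th.
have s0 : 0 < sin th by apply: sin_gt0_pi; rewrite t0.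
have n1 : x ^+ 2 + y ^+ 2 <= 1.
  have [y0|y0] := ltP y 0; first exact: (above_half_disk_norm H y0).
  have ys : 0 <= y * sin th by rewrite mulr_ge0 // ltW.
  have : `|cos th| < 1.
    rewrite -(@ltr_pXn2r _ 2) ?nnegrE // expr1n real_normK ?num_real //.
    by have := exprn_gt0 2 s0; lra.
  rewrite ltr_norml => /andP[k1 k2].
  rewrite /proj /= in c; exfalso; have [cp|cn] := leP 0 (cos th).
    by have := mulr_ge0 (ltac:(lra) : 0 <= x + 1) cp; lra.
  by have := mulr_ge0 (ltac:(lra) : 0 <= 1 - x) (ltac:(lra) : 0 <= - cos th); lra.
rewrite /proj /= in c.
have z : (x + cos th) ^+ 2 + (y + sin th) ^+ 2 <= 0 by nra.
have z1 : (x + cos th) ^+ 2 = 0.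
  by apply/eqP; rewrite eq_le sqr_ge0 andbT; have := sqr_ge0 (y + sin th); lra.
have z2 : (y + sin th) ^+ 2 = 0.
  by apply/eqP; rewrite eq_le sqr_ge0 andbT; have := sqr_ge0 (x + cos th); lra.
move/eqP: z1; rewrite sqrf_eq0 addr_eq0 => /eqP ->.
by move/eqP: z2; rewrite sqrf_eq0 addr_eq0 => /eqP ->.
Qed.

(** The height is at least that of the semicircle, and at most its limit from the
    left. *)
Lemma above_half_disk_squeeze (x y : R) : above_half_disk (x, y) -> -1 < x <= 0 ->
  (forall x', -1 < x' < x -> y <= - Num.sqrt (1 - x' ^+ 2)) ->
  y = - Num.sqrt (1 - x ^+ 2).
Proof.
move=> H /andP[x1 x0] le.
have x20 : 0 <= x ^+ 2 by exact: sqr_ge0.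
have x21 : x ^+ 2 < 1 by rewrite expr2; nra.
have y0 : y < 0.
  have := le ((x - 1) / 2) ltac:(apply/andP; split; lra).
  have : 0 < Num.sqrt (1 - ((x - 1) / 2) ^+ 2) by rewrite sqrtr_gt0 expr2; nra.
  by lra.
have n1 := above_half_disk_norm H y0; rewrite /= in n1.
have y20 : 0 < y ^+ 2 by rewrite expr2 nmulr_rgt0.
apply/eqP; rewrite -eqr_oppLR; apply/eqP.
have -> : - y = Num.sqrt (y ^+ 2) by rewrite sqrtr_sqr ltr0_norm.
congr Num.sqrt; apply/eqP; rewrite eq_le; apply/andP; split; first lra.
rewrite leNgt; apply/negP => lt.
pose m := (x ^+ 2 + (1 - y ^+ 2)) / 2.
have m1 : m < 1 by rewrite /m; lra.
have m0 : x ^+ 2 < m by rewrite /m; lra.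
have sm : Num.sqrt m ^+ 2 = m by rewrite sqr_sqrtr //; lra.
have s0 : 0 <= Num.sqrt m by exact: sqrtr_ge0.
have sm1 : Num.sqrt m < 1 by rewrite -sqrtr1 ltr_sqrt //; lra.
have sx : - x < Num.sqrt m.
  by rewrite -(@ltr_pXn2r _ 2) ?nnegrE ?oppr_ge0 // sqrrN sm.
have := le (- Num.sqrt m) ltac:(apply/andP; split; lra).
have yn0 : 0 <= - y by lra.
rewrite sqrrN sm lerNr -(@ler_pXn2r _ 2) ?nnegrE ?sqrtr_ge0 //.
by rewrite sqr_sqrtr ?sqrrN /m; lra.
Qed.

(** The outer function is only required to be continuous relative to [B], as
    [acos] is on [[-1, 1]]. *)
Lemma within_continuous_comp_in (U V W : topologicalType) (A : set U) (B : set V)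
    (f : U -> V) (g : V -> W) : (forall x, A x -> B (f x)) ->
  {within A, continuous f} -> {within B, continuous g} ->
  {within A, continuous (g \o f)}.
Proof.
move=> fAB /subspace_continuousP cf /subspace_continuousP cg.
apply/subspace_continuousP => x Ax Z nZ.
have := cf x Ax _ (cg _ (fAB x Ax) Z nZ).
rewrite /= !nbhs_simpl /within /=; apply: filterS => t H At.
exact: H At (fAB _ At).
Qed.

Lemma within_continuous_acos : {within `[-1, 1], continuous (@acos R)}.
Proof.
have cc : {within `[0, pi], continuous (@cos R)}.
  by apply: continuous_subspaceT => x; exact: continuous_cos.
have := segment_can_ge_continuous (@pi_ge0 R) cc (@cosK R).
by rewrite cospi cos0.
Qed.

Variables (a b : R) (G : R -> R * R).
Hypothesis ab : a <= b.
Hypothesis var_le : forall th s, 0 <= th <= pi -> path <=%R a s -> last a s = b ->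
  chain_variation th (G a) (map G s) <= proj th (G a) + proj th (G b) + 2.
Hypothesis cov : forall th, exists2 t, a <= t <= b & proj th (G t) <= -1.

(** A path that comes to level [v] in the direction [th] has variation at least
    the sum of the two end levels minus [2 * v]. *)
Lemma extremal_above t : a <= t <= b -> above_half_disk (G t).
Proof.
move=> /andP[at_ tb] th th0.
have := var_le (s := [:: t; b]) th0; rewrite /= at_ tb => /(_ isT erefl).
have := ler_norm (proj th (G a) - proj th (G t)); rewrite distrC.
by have := ler_norm (proj th (G b) - proj th (G t)); lra.
Qed.

(** The directions 0 and [pi] together bound the variation of the abscissa by 2,
    which is used up by passing from -1 to 1. *)
Lemma extremal_endpoints :
  [/\ (G a).1 = -1 & (G b).1 = 1] \/ [/\ (G a).1 = 1 & (G b).1 = -1].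
Proof.
have p0 := @pi_ge0 R.
have i0 : 0 <= (0 : R) <= pi by rewrite lexx.
have ip : 0 <= (pi : R) <= pi by rewrite lexx p0.
have [l /andP[al lb]] := cov 0; rewrite /proj cos0 sin0 mulr1 mulr0 addr0 => lx.
have [r /andP[ar rb]] := cov pi; rewrite /proj cospi sinpi mulrN1 mulr0 addr0 => rx.
have /above_half_disk_x/andP[l1 l2] := extremal_above (introT andP (conj al lb)).
have /above_half_disk_x/andP[r1 r2] := extremal_above (introT andP (conj ar rb)).
have /above_half_disk_x/andP[a1 a2] := extremal_above (introT andP (conj (lexx a) ab)).
have /above_half_disk_x/andP[b1 b2] := extremal_above (introT andP (conj ab (lexx b))).
have [lr|rl] := leP l r; [left|right].
  have := var_le (s := [:: l; r; b]) i0; have := var_le (s := [:: l; r; b]) ip.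
  rewrite /= al lr rb => /(_ isT erefl) + /(_ isT erefl).
  rewrite /proj cospi sinpi cos0 sin0 !mulrN1 !mulr1 !mulr0 !addr0.
  have := ler_norm ((G a).1 - (G l).1); have := ler_norm ((G r).1 - (G l).1).
  have := ler_norm ((G r).1 - (G b).1); rewrite !opprK.
  have e (x y : R) : `|- x + y| = `|x - y| by rewrite addrC distrC.
  rewrite !e (distrC (G a).1) (distrC (G r).1 (G b).1).
  by move=> *; split; lra.
have {}rl := ltW rl.
have := var_le (s := [:: r; l; b]) i0; have := var_le (s := [:: r; l; b]) ip.
rewrite /= ar rl lb => /(_ isT erefl) + /(_ isT erefl).
rewrite /proj cospi sinpi cos0 sin0 !mulrN1 !mulr1 !mulr0 !addr0.
have := ler_norm ((G r).1 - (G a).1); have := ler_norm ((G r).1 - (G l).1).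
have := ler_norm ((G b).1 - (G l).1); rewrite !opprK.
have e (x y : R) : `|- x + y| = `|x - y| by rewrite addrC distrC.
rewrite !e (distrC (G l).1 (G r).1).
by move=> *; split; lra.
Qed.

Hypothesis Ga : G a = (-1, 1).
Hypothesis Gb : G b = (1, 1).

(** The variation of the abscissa is its total increase. *)
Lemma extremal_x_nondecreasing s t : a <= s -> s <= t -> t <= b -> (G s).1 <= (G t).1.
Proof.
move=> as_ st tb.
have := var_le (s := [:: s; t; b]) (th := 0) ltac:(by rewrite lexx pi_ge0).
rewrite /= as_ st tb => /(_ isT erefl).
rewrite /proj cos0 sin0 !mulr1 !mulr0 !addr0 Ga Gb /=.
have := ler_norm ((G s).1 - -1); have := ler_norm ((G s).1 - (G t).1); rewrite distrC.
by have := ler_norm (1 - (G t).1); lra.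
Qed.

Lemma extremal_lowest : exists2 m, a <= m <= b & G m = (0, -1).
Proof.
have [m mab pm] := cov (pi / 2); exists m => //.
rewrite (above_half_disk_contact (extremal_above mab) _ pm) ?cos_pihalf ?sin_pihalf ?oppr0 //.
by have := @pi_gt0 R => *; apply/andP; split; lra.
Qed.

Lemma extremal_y_nonincreasing m s t : G m = (0, -1) -> m <= b ->
  a <= s -> s <= t -> t <= m -> (G t).2 <= (G s).2.
Proof.
move=> Gm mb as_ st tm.
have := var_le (s := [:: s; t; m; b]) (th := pi / 2)
  ltac:(have := @pi_ge0 R => *; apply/andP; split; lra).
rewrite /= as_ st tm mb => /(_ isT erefl).
rewrite /proj cos_pihalf sin_pihalf !mulr1 !mulr0 !add0r Ga Gb Gm /=.
have := ler_norm (1 - (G s).2); have := ler_norm ((G t).2 - (G s).2); rewrite distrC.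
have := ler_norm ((G t).2 - -1); have := ler_norm (1 - -1 : R); rewrite (distrC 1 (G s).2) (distrC (G t).2 (-1)).
by rewrite (distrC (G s).2 (G t).2); lra.
Qed.

Lemma extremal_y_nondecreasing m s t : G m = (0, -1) -> a <= m ->
  m <= s -> s <= t -> t <= b -> (G s).2 <= (G t).2.
Proof.
move=> Gm am ms st tb.
have := var_le (s := [:: m; s; t; b]) (th := pi / 2)
  ltac:(have := @pi_ge0 R => *; apply/andP; split; lra).
rewrite /= am ms st tb => /(_ isT erefl).
rewrite /proj cos_pihalf sin_pihalf !mulr1 !mulr0 !add0r Ga Gb Gm /=.
have := ler_norm (1 - (G t).2); have := ler_norm ((G s).2 - (G t).2); rewrite distrC.
have := ler_norm ((G s).2 - -1); have := ler_norm (1 - -1 : R); rewrite (distrC 1 (-1)).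
by lra.
Qed.

Lemma extremal_arc x : -1 < x < 1 ->
  exists2 t, a <= t <= b & G t = (x, - Num.sqrt (1 - x ^+ 2)).
Proof.
move=> /andP[x1 x2].
have xi : -1 <= - x <= 1 by apply/andP; split; lra.
have [t tab pt] := cov (acos (- x)); exists t => //.
rewrite (above_half_disk_contact (extremal_above tab) _ pt).
  by rewrite acosK ?in_itv //= opprK sin_acos // sqrrN.
by rewrite acos_gt0 ?acos_ltpi //; apply/andP; split; lra.
Qed.

(** Before the lowest point, the abscissa increases and the height decreases.
    Therefore, when the path has abscissa [x], it has already been at the points
    of the semicircle with abscissa smaller than [x], so that it cannot be higher
    than the semicircle, unless [x = -1]. *)
Lemma extremal_position m t : G m = (0, -1) -> a <= m <= b -> a <= t <= b ->
  [\/ [/\ t <= m, (G t).1 = -1 & 0 <= (G t).2],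
      -1 < (G t).1 < 1 /\ (G t).2 = - Num.sqrt (1 - (G t).1 ^+ 2) |
      [/\ m <= t, (G t).1 = 1 & 0 <= (G t).2]].
Proof.
move=> Gm /andP[am mb] /andP[at_ tb].
have ad := extremal_above (introT andP (conj at_ tb)).
have /andP[x1 x2] := above_half_disk_x ad.
have yside : (G t).1 ^+ 2 = 1 -> 0 <= (G t).2.
  move=> x21; rewrite leNgt; apply/negP => y0.
  have := above_half_disk_norm ad y0; rewrite x21.
  have : 0 < (G t).2 ^+ 2 by rewrite expr2 nmulr_rgt0.
  by lra.
have [tm|mt] := leP t m.
  have x0 : (G t).1 <= 0 by have := extremal_x_nondecreasing at_ tm mb; rewrite Gm.
  have [e|ne] := eqVneq (G t).1 (-1).
    by apply: Or31; split => //; apply: yside; rewrite e sqrrN expr1n.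
  have lt1 : -1 < (G t).1 by rewrite lt_def ne.
  apply: Or32; split; first by apply/andP; split; lra.
  apply: above_half_disk_squeeze; [by rewrite -surjective_pairing|by rewrite lt1|].
  move=> x' /andP[x'1 x'2].
  have [t' /andP[at' t'b] e'] := extremal_arc (x := x') ltac:(apply/andP; split; lra).
  have t't : t' <= t.
    rewrite leNgt; apply/negP => /ltW tt'.
    by have := extremal_x_nondecreasing at_ tt' t'b; rewrite e' /=; lra.
  by have := extremal_y_nonincreasing Gm mb at' t't tm; rewrite e'.
have {}mt := ltW mt.
have x0 : 0 <= (G t).1 by have := extremal_x_nondecreasing am mt tb; rewrite Gm.
have [e|ne] := eqVneq (G t).1 1.
  by apply: Or33; split => //; apply: yside; rewrite e expr1n.
have lt1 : (G t).1 < 1 by rewrite lt_def eq_sym ne.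
apply: Or32; split; first by apply/andP; split; lra.
rewrite -sqrrN; apply: above_half_disk_squeeze.
- move=> th /andP[th0 thp].
  have := ad (pi - th) ltac:(apply/andP; split; lra).
  by rewrite /proj cosB sinB cospi sinpi /=; lra.
- apply/andP; split; lra.
move=> x' /andP[x'1 x'2].
have [t' /andP[at' t'b] e'] := extremal_arc (x := - x') ltac:(apply/andP; split; lra).
have tt' : t <= t'.
  rewrite leNgt; apply/negP => /ltW t't.
  by have := extremal_x_nondecreasing at' t't tb; rewrite e' /=; lra.
by have := extremal_y_nondecreasing Gm am mt tt' t'b; rewrite e' /= sqrrN.
Qed.

Lemma extremal_unit_path t : a <= t <= b -> unit_path (unit_path_inv (G t)) = G t.
Proof.
move=> tab; have [m mab Gm] := extremal_lowest.
rewrite [in RHS](surjective_pairing (G t)) [in LHS](surjective_pairing (G t)).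
case: (extremal_position Gm mab tab) => [[_ -> y0]|[x1 ->]|[_ -> y0]].
- exact: unit_path_invK_left.
- exact: unit_path_invK_arc.
- exact: unit_path_invK_right.
Qed.

Lemma extremal_param_nondecreasing s t : a <= s -> s <= t -> t <= b ->
  unit_path_inv (G s) <= unit_path_inv (G t).
Proof.
move=> as_ st tb; have [m /[dup] mab /andP[am mb] Gm] := extremal_lowest.
have tab : a <= t <= b by rewrite (le_trans as_).
have sab : a <= s <= b by rewrite as_ (le_trans st).
have xst := extremal_x_nondecreasing as_ st tb.
have arc (x : R) : -1 < x < 1 -> unit_path_inv (x, - Num.sqrt (1 - x ^+ 2)) = acos (- x).
  by move=> _; rewrite /unit_path_inv /= (max_idPr _) ?oppr_le0 ?sqrtr_ge0 // mulr0 addr0.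
have left (y : R) : 0 <= y -> unit_path_inv (-1, y) = - y.
  by move=> y0; rewrite /unit_path_inv /= opprK acos1 add0r (max_idPl y0) mulN1r.
have right (y : R) : 0 <= y -> unit_path_inv (1, y) = pi + y.
  by move=> y0; rewrite /unit_path_inv /= acosN1 (max_idPl y0) mul1r.
have p0 := @pi_ge0 R.
have arc_in (x : R) : -1 < x < 1 -> 0 <= acos (- x) <= pi.
  by move=> /andP[? ?]; rewrite acos_ge0 ?acos_lepi //; apply/andP; split; lra.
rewrite (surjective_pairing (G s)) (surjective_pairing (G t)).
case: (extremal_position Gm mab tab) => [[tm xt yt]|[xt yt]|[mt xt yt]];
case: (extremal_position Gm mab sab) => [[sm xs ys]|[xs ys]|[ms xs ys]].
- rewrite xt xs !left //; have := extremal_y_nonincreasing Gm mb as_ st tm; lra.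
- by exfalso; move: xs xst; rewrite xt => /andP[]; lra.
- by exfalso; move: xst; rewrite xt xs; lra.
- by rewrite xs left // yt arc //; have /andP[] := arc_in _ xt; lra.
- rewrite ys yt !arc // leNgt; apply/negP => lt.
  have /andP[? ?] := arc_in _ xs; have /andP[? ?] := arc_in _ xt.
  move: lt; rewrite -ltr_cos ?in_itv ?arc_in // !acosK ?in_itv //=.
  + by lra.
  + by move/andP: xt => [? ?]; apply/andP; split; lra.
  + by move/andP: xs => [? ?]; apply/andP; split; lra.
- by exfalso; move: xt xst; rewrite xs => /andP[]; lra.
- by rewrite xs xt left // right //; lra.
- by rewrite xt right // ys arc //; have /andP[] := arc_in _ xs; lra.
- rewrite xt xs !right //; have := extremal_y_nondecreasing Gm am ms st tb; lra.
Qed.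

Lemma extremal_param_ends :
  unit_path_inv (G a) = -1 /\ unit_path_inv (G b) = pi + 1.
Proof.
rewrite Ga Gb /unit_path_inv /= opprK acos1 acosN1.
have -> : Num.max 1 0 = 1 :> R by apply/max_idPl.
by rewrite add0r mulr1 mulr1.
Qed.

Lemma extremal_param_continuous : {within `[a, b], continuous G} ->
  {within `[a, b], continuous (unit_path_inv \o G)}.
Proof.
move=> cG.
have cx : {within `[a, b], continuous (fun t => (G t).1)}.
  by move=> t; apply: (@cvg_comp _ _ _ _ fst _ _ _ (cG t)); exact: cvg_fst.
have cy : {within `[a, b], continuous (fun t => (G t).2)}.
  by move=> t; apply: (@cvg_comp _ _ _ _ snd _ _ _ (cG t)); exact: cvg_snd.
have c1 : {within `[a, b], continuous (fun t => - (G t).1)}.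
  by move=> t; apply: cvgN; exact: cx.
have ca : {within `[a, b], continuous (fun t => acos (- (G t).1))}.
  apply: (within_continuous_comp_in _ c1 within_continuous_acos).
  move=> t /=; rewrite in_itv /= => tab.
  have /above_half_disk_x/andP[? ?] := extremal_above tab.
  by rewrite in_itv /=; apply/andP; split; lra.
have cm : {within `[a, b], continuous (fun t => Num.max (G t).2 0)}.
  move=> t; apply: (@continuous_max _ _ (fun t : subspace `[a, b] => (G t).2) (cst 0) t (cy t)).
  exact: cvg_cst.
move=> t; apply: cvgD; first exact: ca.
by apply: cvgM; [exact: cx|exact: cm].
Qed.

End UnitExtremal.

(** * A direction visited at levels 1, -1, 1 *)

Section ThreeVisits.
Variable R : realType.
Local Open Scope classical_set_scope.

(** Continuity on a segment becomes continuity on the line, which permits the use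
    of products of compact sets below. *)
Lemma continuous_clamp (T : topologicalType) (a b : R) (G : R -> T) : a <= b ->
  {within `[a, b], continuous G} ->
  continuous (fun t => G (Num.max a (Num.min t b))).
Proof.
move=> ab cG.
have cc : continuous (fun t : R => Num.max a (Num.min t b)).
  move=> t; apply: (@continuous_max R R (cst a) (fun t => Num.min t b)); first exact: cvg_cst.
  by apply: (@continuous_min R R id (cst b)); [exact: cvg_id|exact: cvg_cst].
apply/continuous_subspace_setT.
apply: (within_continuous_comp_in (B := `[a, b]) _ _ cG).
  move=> t _; rewrite /= in_itv /= le_max lexx /= ge_max ab /=.
  by rewrite ge_min lexx orbT.
exact: continuous_subspaceT.
Qed.

Lemma clamp_id (a b t : R) : a <= t <= b -> Num.max a (Num.min t b) = t.
Proof. by move=> /andP[at_ tb]; rewrite (min_idPl tb) (max_idPr at_). Qed.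

Lemma projDpi th (p : R * R) : proj (th + pi) p = - proj th p.
Proof. by rewrite /proj cosDpi sinDpi; ring. Qed.

Section Visits.
Variables (a b : R) (G : R -> R * R).
Hypothesis ab : a <= b.
Hypothesis cG : {within `[a, b], continuous G}.
Hypothesis cov : forall th, exists2 t, a <= t <= b & 1 <= proj th (G t).

Definition high_then_low th : Prop := exists s t,
  [/\ a <= s, s <= t, t <= b, 1 <= proj th (G s) & proj th (G t) <= -1].

(** Compare the times at which the path enters the two opposite half planes. *)
Lemma high_then_low_or th : high_then_low th \/ high_then_low (th + pi).
Proof.
have [s /andP[as_ sb] ps] := cov th; have [t /andP[at_ tb]] := cov (th + pi).
rewrite projDpi => pt; have [st|ts] := leP s t.
  by left; exists s, t; split => //; lra.
by right; exists t, s; rewrite !projDpi; split => //; [exact: ltW|lra].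
Qed.

(** It is the image of a compact set of triples (direction, first time, second
    time). *)
Lemma closed_high_then_low c :
  closed [set th : R | 0 <= th <= pi /\ high_then_low (th + c)].
Proof.
pose Gc t := G (Num.max a (Num.min t b)).
have cGc : continuous Gc by exact: continuous_clamp.
have cproj (i : R * (R * R) -> R) : continuous i ->
    continuous (fun z : R * (R * R) => proj (z.1 + c) (Gc (i z))).
  move=> ci z.
  have cth : {for z, continuous (fun z : R * (R * R) => z.1 + c)}.
    by apply: cvgD; [exact: cvg_fst|exact: cvg_cst].
  have cGi : {for z, continuous (fun z : R * (R * R) => Gc (i z))}.
    by apply: continuous_comp; [exact: ci|exact: cGc].
  apply: cvgD; apply: cvgM.
  - by apply: (@cvg_comp _ _ _ _ fst _ _ _ cGi); exact: cvg_fst.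
  - by apply: (@cvg_comp _ _ _ _ cos _ _ _ cth); exact: continuous_cos.
  - by apply: (@cvg_comp _ _ _ _ snd _ _ _ cGi); exact: cvg_snd.
  - by apply: (@cvg_comp _ _ _ _ sin _ _ _ cth); exact: continuous_sin.
have c1 : continuous (fun z : R * (R * R) => z.2.1).
  by move=> z; apply: (@cvg_comp _ _ _ snd fst); [exact: cvg_snd|exact: cvg_fst].
have c2 : continuous (fun z : R * (R * R) => z.2.2).
  by move=> z; apply: (@cvg_comp _ _ _ snd snd); [exact: cvg_snd|exact: cvg_snd].
pose box := `[(0 : R), pi] `*` (`[a, b] `*` `[a, b]).
pose F1 := [set z : R * (R * R) | 0 <= z.2.2 - z.2.1].
pose F2 := [set z : R * (R * R) | 1 <= proj (z.1 + c) (Gc z.2.1)].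
pose F3 := [set z : R * (R * R) | proj (z.1 + c) (Gc z.2.2) <= -1].
have F1c : closed F1.
  apply: (@preimage_closed _ _ (fun z : R * (R * R) => z.2.2 - z.2.1) [set x | 0 <= x]).
    by move=> z _; apply: cvgB; [exact: c2|exact: c1].
  exact: closed_ge.
have F2c : closed F2.
  apply: (@preimage_closed _ _ (fun z : R * (R * R) => proj (z.1 + c) (Gc z.2.1)) [set x | 1 <= x]).
    by move=> z _; exact: cproj c1 z.
  exact: closed_ge.
have F3c : closed F3.
  apply: (@preimage_closed _ _ (fun z : R * (R * R) => proj (z.1 + c) (Gc z.2.2)) [set x | x <= -1]).
    by move=> z _; exact: cproj c2 z.
  exact: closed_le.
have boxc : compact box.
  by apply: compact_setX; [|apply: compact_setX]; exact: segment_compact.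
have Kc : compact (box `&` (F1 `&` (F2 `&` F3))).
  apply: (subclosed_compact _ boxc); last exact: subIsetl.
  apply: closedI; last by apply: closedI => //; exact: closedI.
  by apply: compact_closed boxc; exact: norm_hausdorff.
suff -> : [set th : R | 0 <= th <= pi /\ high_then_low (th + c)] =
    fst @` (box `&` (F1 `&` (F2 `&` F3))).
  apply: compact_closed; first exact: norm_hausdorff.
  by apply: continuous_compact Kc; apply: continuous_subspaceT => z; exact: cvg_fst.
apply/seteqP; split => [th [th0 [s [t [as_ st tb ps pt]]]]|th].
  have sab : a <= s <= b by rewrite as_ (le_trans st).
  have tab : a <= t <= b by rewrite tb (le_trans as_).
  exists (th, (s, t)) => //; split; first by rewrite /box /= !in_itv /= th0 sab tab.
  by rewrite /F1 /F2 /F3 /= /Gc !clamp_id // subr_ge0.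
move=> [[th' [s t]]] [[/= + [+ +]] []]; rewrite /= !in_itv /= /F1 /F2 /F3 /=.
move=> th0 sab tab; rewrite subr_ge0 => st [ps pt] <-; split=> //.
move: ps pt; rewrite /Gc !clamp_id // => ps pt.
by case/andP: sab tab => as_ _ /andP[_ tb]; exists s, t.
Qed.

(** By connectedness of [[0, pi]], some direction [th] and its opposite are both of
    the kind [high_then_low].  Of the two descents, the one that begins first
    supplies the first two visits, and the other one the third. *)
Lemma three_visits : exists th t1 t2 t3,
  [/\ a <= t1, t1 <= t2, t2 <= t3 & t3 <= b] /\
  [/\ 1 <= proj th (G t1), proj th (G t2) <= -1 & 1 <= proj th (G t3)].
Proof.
have p0 := @pi_ge0 R.
have [th [E1 E2]] : exists th, high_then_low th /\ high_then_low (th + pi).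
  apply: contrapT => no.
  have {}no th : high_then_low th -> ~ high_then_low (th + pi).
    by move=> E1 E2; apply: no; exists th.
  pose A := [set th : R | 0 <= th <= pi /\ high_then_low (th + 0)].
  have AI : A !=set0 -> A = `[0, pi].
    move=> A0; apply: segment_connected => //.
      exists (~` [set th : R | 0 <= th <= pi /\ high_then_low (th + pi)]).
        by apply: closed_openC; exact: (@closed_high_then_low pi).
      apply/seteqP; split=> th; rewrite /A /= addr0 in_itv /=.
        by move=> [th0 E]; split => // -[_ /(no _ E)].
      by move=> [th0 nE]; split => //; case: (high_then_low_or th) => // E; exfalso; apply: nE.
    exists A; first exact: (@closed_high_then_low 0).
    by apply/seteqP; split=> th [] // th0 E; split.
  have := high_then_low_or 0; rewrite add0r => -[E|E].
    have /AI e : A !=set0 by exists 0; rewrite /A /= addr0 lexx.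
    have : A pi by rewrite e /= in_itv /= lexx andbT.
    by rewrite /A /= addr0 => -[_]; have := no _ E; rewrite add0r.
  have /AI e : A !=set0 by exists pi; rewrite /A /= addr0 lexx andbT.
  have : A 0 by rewrite e /= in_itv /= lexx.
  by rewrite /A /= addr0 => -[_ /no]; rewrite add0r.
case: E1 => s1 [t1 [as1 st1 tb1 ps1 pt1]]; case: E2 => s2 [t2 [as2 st2 tb2]].
rewrite !projDpi => ps2 pt2.
have [s12|s21] := leP s1 s2.
  by exists th, s1, s2, t2; split; split => //; lra.
exists (th + pi), s2, s1, t1; rewrite !projDpi; split; split => //; lra.
Qed.

End Visits.
End ThreeVisits.

(** * Lengths, isometries, tangent lines and the U-shaped path *)

Section CurveLength.
Variable R : realType.
Local Open Scope classical_set_scope.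
Implicit Types (g h : curve R) (L k : R).

Lemma polygon_lengthE g s : polygon_length g s = chain_length (g (lo g)) (map g s).
Proof.
rewrite /polygon_length /=; elim: s (lo g) => [|y s IH] x /=; first by rewrite big_geq.
by rewrite big_nat_recl //= -IH.
Qed.

(** Repeated times contribute nothing and may be removed. *)
Lemma strict_chain (G : R -> R * R) (a : R) (s : seq R) : path <=%R a s ->
  exists s', [/\ path <%R a s', last a s' = last a s &
    chain_length (G a) (map G s') = chain_length (G a) (map G s)].
Proof.
elim: s a => [|x s IH] a /=; first by exists [::].
move=> /andP[ax /IH[s' [ps' ls' e]]]; have [->|ne] := eqVneq a x.
  by exists s'; rewrite edistxx add0r.
by exists (x :: s'); rewrite /= lt_neqAle ne ax ps' ls' e.
Qed.

Lemma curve_length_leP g L : lo g <= hi g ->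
  (curve_length g <= L%:E)%E <-> chains_bounded g (lo g) (hi g) L.
Proof.
move=> lohi; split=> [le s ps ls|cb].
  have ps' : path <=%R (lo g) (rcons s (hi g)) by rewrite rcons_path ps.
  have [s' [p' l' e]] := strict_chain g ps'.
  rewrite last_rcons in l'.
  rewrite -lee_fin (le_trans _ le) //.
  apply: (@le_trans _ _ (polygon_length g s')%:E).
    rewrite lee_fin polygon_lengthE e map_rcons -cats1 chain_length_cat lerDl.
    exact: chain_length_ge0.
  by apply: ereal_sup_ubound; exists s' => //; split => //; apply/eqP.
apply: ub_ereal_sup => _ [s [ps /eqP ls] <-]; rewrite lee_fin polygon_lengthE.
by apply: cb; rewrite ?ls //; apply: sub_path ps => x y; exact: ltW.
Qed.

Lemma plane_path_length g : plane_path g -> exists L, curve_length g = L%:E.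
Proof.
case=> lohi _ fin; exists (fine (curve_length g)); rewrite fineK // fin_numElt fin andbT.
have ph : path <=%R (lo g) [:: hi g] by rewrite /= lohi.
have [s' [p' l' e]] := strict_chain g ph.
apply: (@lt_le_trans _ _ (polygon_length g s')%:E); first exact: ltNyr.
by apply: ereal_sup_ubound; exists s' => //; split => //; apply/eqP; rewrite l'.
Qed.

Lemma lipschitz_chains_bounded (G : R -> R * R) (a b k : R) : 0 <= k ->
  (forall s t, edist (G t) (G s) <= k * `|t - s|) ->
  chains_bounded G a b (k * (b - a)).
Proof.
move=> k0 lip s; elim: s a => [|x s IH] a /=.
  by move=> _ ab; rewrite mulr_ge0 // subr_ge0.
move=> /andP[ax ps] ls; have := IH x ps ls; have := lip a x.
by rewrite ger0_norm ?subr_ge0 //; lra.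
Qed.

Lemma chain_length_similar (f : R * R -> R * R) (k : R) p s :
  (forall p q, edist (f p) (f q) = k * edist p q) ->
  chain_length (f p) (map f s) = k * chain_length p s.
Proof.
by move=> ef; elim: s p => [|q s IH] p /=; rewrite ?mulr0 // ef IH mulrDr.
Qed.

Lemma chains_bounded_similar (f : R * R -> R * R) (k : R) (G : R -> R * R) a b L :
  0 <= k -> (forall p q, edist (f p) (f q) = k * edist p q) ->
  chains_bounded G a b L -> chains_bounded (f \o G) a b (k * L).
Proof.
move=> k0 ef cb s ps ls; rewrite map_comp /= (chain_length_similar _ _ ef).
by rewrite ler_wpM2l // cb.
Qed.

(** Take preimages successively, by the intermediate value theorem, in the part of
    the interval that is left. *)
Lemma lift_times (a b : R) (u : R -> R) (x : R) (s : seq R) : a <= b ->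
  {within `[a, b], continuous u} -> u a = x -> path <=%R x s -> last x s <= u b ->
  exists s', [/\ path <=%R a s', last a s' <= b & map u s' = s].
Proof.
elim: s a x => [|y s IH] a x /=; first by exists [::].
move=> ab cu ua /andP[xy ps] ls.
have yb : y <= u b by apply: le_trans ls; case/andP: (mem_path_le ps (mem_head y s)).
have [|t] := IVT ab cu (v := y).
  by rewrite ua ge_min xy le_max yb orbT.
rewrite in_itv /= => /andP[at_ tb] ut.
have cut : {within `[t, b], continuous u}.
  apply: continuous_subspaceW cu => z /=; rewrite !in_itv /= => /andP[tz ->].
  by rewrite (le_trans at_).
have [s' [p' l' e']] := IH t y tb cut ut ps ls.
by exists (t :: s'); rewrite /= at_ ut e'.
Qed.

(** Every chain of [g] is also a chain of [h], possibly with repetitions. *)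
Lemma reparametrization_chains_bounded g h L : same_up_to_reparametrization g h ->
  chains_bounded h (lo h) (hi h) L -> chains_bounded g (lo g) (hi g) L.
Proof.
move=> [a [b [u [v [ab [cu mu ua ub] [cv mv va vb] guv]]]]] cb s ps ls.
have ls' : last (lo g) s <= u b by rewrite ub.
have [s' [p' l' e']] := lift_times ab cu ua ps ls'.
have inab : forall t, t \in a :: s' -> t \in `[a, b]%R.
  by move=> t /(mem_path_le p')/andP[? ?]; rewrite in_itv /=; apply/andP; split => //; exact: le_trans l'.
have -> : chain_length (g (lo g)) (map g s) = chain_length (h (lo h)) (map h (map v s')).
  rewrite -ua guv ?inab ?mem_head // va -e' -!map_comp; congr chain_length.
  by apply/eq_in_map => t ts /=; rewrite guv // inab // inE ts orbT.
have vs : {in a :: s' &, {homo v : x y / x <= y}}.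
  by move=> x y xs ys; apply: mv; exact: inab.
apply: cb; rewrite -va; last first.
  rewrite last_map -vb; apply: mv => //; first by rewrite inab // mem_last.
  by rewrite in_itv /= ab lexx.
by apply: (homo_path_in vs) => //; apply/allP => t.
Qed.

Lemma reparametrization_meets g h K : same_up_to_reparametrization g h ->
  meets_all_tangents K h -> meets_all_tangents K g.
Proof.
move=> [a [b [u [v [ab [cu mu ua ub] [cv mv va vb] guv]]]]] mh L /mh[t].
rewrite in_itv /= => tlh Lt.
have [|x xab vx] := IVT ab cv (v := t).
  by rewrite va vb; case/andP: tlh => l1 l2; rewrite ge_min l1 le_max l2 orbT.
exists (u x); last by rewrite guv // vx.
have [a_in b_in] : a \in `[a, b]%R /\ b \in `[a, b]%R by rewrite !in_itv /= !lexx ab.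
have := xab; rewrite in_itv /= => /andP[ax xb].
by rewrite in_itv /= -ua -ub; apply/andP; split; exact: mu.
Qed.

End CurveLength.

Section Isometries.
Variable R : realType.
Local Open Scope classical_set_scope.
Implicit Types (c o p q : R * R) (r t th : R).

(** Coordinates in which the circle of center [c] and radius [r] is the unit circle
    and the axes are turned by [t]. *)
Definition frame c r t p : R * R :=
  ((cos t * (p.1 - c.1) + sin t * (p.2 - c.2)) / r,
   (cos t * (p.2 - c.2) - sin t * (p.1 - c.1)) / r).

Definition homothety c r p : R * R := (c.1 + r * p.1, c.2 + r * p.2).

Lemma rotation_frame c r t p : r != 0 ->
  rotation c t (homothety c r (frame c r t p)) = p.
Proof.
move=> r0; have e := cos2Dsin2 t; case: p => x y.
rewrite /rotation /homothety /frame /=; set C := cos t in e *; set S := sin t in e *.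
congr (_, _).
- transitivity (c.1 + (C ^+ 2 + S ^+ 2) * (x - c.1)); last by rewrite e; ring.
  by field.
- transitivity (c.2 + (C ^+ 2 + S ^+ 2) * (y - c.2)); last by rewrite e; ring.
  by field.
Qed.

Lemma frame_homothety c r p : r != 0 -> frame c r 0 (homothety c r p) = p.
Proof.
move=> r0; case: p => x y; rewrite /frame /homothety /= cos0 sin0.
by congr (_, _); field.
Qed.

Lemma proj_frame c r t th p :
  proj th (frame c r t p) = proj (th + t) (frame c r 0 p).
Proof. by rewrite /proj /frame /= cos0 sin0 cosD sinD; ring. Qed.

Lemma edist_homothety c r p q : 0 <= r ->
  edist (homothety c r p) (homothety c r q) = r * edist p q.
Proof.
move=> r0; rewrite /edist /= -[in RHS](ger0_norm r0) -sqrtr_sqr -sqrtrM ?sqr_ge0 //.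
by congr Num.sqrt; ring.
Qed.

Lemma edist_rotation o t p q : edist (rotation o t p) (rotation o t q) = edist p q.
Proof.
rewrite /edist /rotation /=; congr Num.sqrt; have e := cos2Dsin2 t.
transitivity ((cos t ^+ 2 + sin t ^+ 2) * ((p.1 - q.1) ^+ 2 + (p.2 - q.2) ^+ 2)).
  by ring.
by rewrite e mul1r.
Qed.

Lemma edist_reflection o t p q : edist (reflection o t p) (reflection o t q) = edist p q.
Proof.
rewrite /edist /reflection /=; congr Num.sqrt; have e := cos2Dsin2 t.
transitivity ((cos t ^+ 2 + sin t ^+ 2) * ((p.1 - q.1) ^+ 2 + (p.2 - q.2) ^+ 2)).
  by ring.
by rewrite e mul1r.
Qed.

Lemma edist_frame c r t p q : 0 < r ->
  edist (frame c r t p) (frame c r t q) = r^-1 * edist p q.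
Proof.
move=> r0; have rn : r != 0 by rewrite gt_eqF.
rewrite -[in RHS](rotation_frame c t p rn) -[in RHS](rotation_frame c t q rn).
by rewrite edist_rotation edist_homothety ?ltW // mulKf.
Qed.

Lemma rotation_image_circle c r t : rotation c t @` circle c r = circle c r.
Proof.
have fix_c s : rotation c s c = c.
  by rewrite /rotation !subrr !mulr0 subr0 !addr0 -surjective_pairing.
apply/seteqP; split=> [_ [p Kp <-]|p Kp].
  by rewrite /circle /=; have := edist_rotation c t p c; rewrite fix_c => ->.
exists (rotation c (- t) p).
  by rewrite /circle /=; have := edist_rotation c (- t) p c; rewrite fix_c => ->.
have e := cos2Dsin2 t; case: p {Kp} => x y; rewrite /rotation /= cosN sinN; congr (_, _).
- transitivity (c.1 + (cos t ^+ 2 + sin t ^+ 2) * (x - c.1)); last by rewrite e; ring.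
  by ring.
- transitivity (c.2 + (cos t ^+ 2 + sin t ^+ 2) * (y - c.2)); last by rewrite e; ring.
  by ring.
Qed.

Lemma reflection_image_circle c r t : reflection c t @` circle c r = circle c r.
Proof.
have fix_c s : reflection c s c = c.
  by rewrite /reflection !subrr !mulr0 subr0 !addr0 -surjective_pairing.
have sub p : circle c r p -> circle c r (reflection c t p).
  by move=> Kp; rewrite /circle /=; have := edist_reflection c t p c; rewrite fix_c => ->.
apply/seteqP; split=> [_ [p Kp <-]|p Kp]; first exact: sub.
exists (reflection c t p); first exact: sub.
have e := cos2Dsin2 t; case: p {Kp} => x y; rewrite /reflection /=; congr (_, _).
- transitivity (c.1 + (cos t ^+ 2 + sin t ^+ 2) * (x - c.1)); last by rewrite e; ring.
  by ring.
- transitivity (c.2 + (cos t ^+ 2 + sin t ^+ 2) * (y - c.2)); last by rewrite e; ring.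
  by ring.
Qed.

(** The parallelogram identity: if both [w + v] and [w - v] have the length [r] of
    [v], then [w] is 0. *)
Lemma midpoint_center (a b d e r : R) : 0 <= r -> d ^+ 2 + e ^+ 2 = r ^+ 2 ->
  Num.sqrt ((a + d) ^+ 2 + (b + e) ^+ 2) = r ->
  Num.sqrt ((a - d) ^+ 2 + (b - e) ^+ 2) = r -> a = 0 /\ b = 0.
Proof.
move=> r0 de h1 h2.
have k1 : (a + d) ^+ 2 + (b + e) ^+ 2 = r ^+ 2.
  by rewrite -h1 sqr_sqrtr // addr_ge0 ?sqr_ge0.
have k2 : (a - d) ^+ 2 + (b - e) ^+ 2 = r ^+ 2.
  by rewrite -h2 sqr_sqrtr // addr_ge0 ?sqr_ge0.
have a2 := sqr_ge0 a; have b2 := sqr_ge0 b.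
have s0 : a ^+ 2 + b ^+ 2 = 0 by lra.
by split; apply/eqP; rewrite -sqrf_eq0; apply/eqP; lra.
Qed.

(** The image of the center is the midpoint of the images of two opposite points
    of the circle, hence it is the center. *)
Lemma isometry_fixes_center s c r : 0 < r -> rotation_or_reflection s ->
  s @` circle c r = circle c r ->
  exists t, (forall p, s p = rotation c t p) \/ (forall p, s p = reflection c t p).
Proof.
move=> r0 [] o [t sE] sK; exists t; have r00 := ltW r0.
have onK (e : R) : e ^+ 2 = r ^+ 2 -> circle c r (s (c.1 + e, c.2)).
  move=> er; rewrite -sK; exists (c.1 + e, c.2) => //.
  rewrite /circle /= /edist /= subrr expr0n addr0 addrC addKr er.
  by rewrite sqrtr_sqr ger0_norm.
have k1 := onK r erefl; have k2 := onK (- r) (sqrrN r).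
have dr (C S : R) : C ^+ 2 + S ^+ 2 = 1 -> (C * r) ^+ 2 + (S * r) ^+ 2 = r ^+ 2.
  by move=> CS; rewrite !exprMn -mulrDl CS mul1r.
have {}dr := dr _ _ (cos2Dsin2 t).
case: sE => sE; [left|right]; move=> p; rewrite sE /circle /= /edist /= in k1 k2 *.
- set d1 := o.1 + (cos t * (c.1 - o.1) - sin t * (c.2 - o.2)) - c.1.
  set d2 := o.2 + (sin t * (c.1 - o.1) + cos t * (c.2 - o.2)) - c.2.
  have [z1 z2] : d1 = 0 /\ d2 = 0.
    apply: (midpoint_center r00 dr); [rewrite -[RHS]k1|rewrite -[RHS]k2]; rewrite /d1 /d2;
      by congr Num.sqrt; ring.
  rewrite /rotation; congr (_, _).
    transitivity (c.1 + (cos t * (p.1 - c.1) - sin t * (p.2 - c.2)) + d1); last by rewrite z1 addr0.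
    by rewrite /d1; ring.
  transitivity (c.2 + (sin t * (p.1 - c.1) + cos t * (p.2 - c.2)) + d2); last by rewrite z2 addr0.
  by rewrite /d2; ring.
- set d1 := o.1 + (cos t * (c.1 - o.1) + sin t * (c.2 - o.2)) - c.1.
  set d2 := o.2 + (sin t * (c.1 - o.1) - cos t * (c.2 - o.2)) - c.2.
  have [z1 z2] : d1 = 0 /\ d2 = 0.
    apply: (midpoint_center r00 dr); [rewrite -[RHS]k1|rewrite -[RHS]k2]; rewrite /d1 /d2;
      by congr Num.sqrt; ring.
  rewrite /reflection; congr (_, _).
    transitivity (c.1 + (cos t * (p.1 - c.1) + sin t * (p.2 - c.2)) + d1); last by rewrite z1 addr0.
    by rewrite /d1; ring.
  transitivity (c.2 + (sin t * (p.1 - c.1) - cos t * (p.2 - c.2)) + d2); last by rewrite z2 addr0.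
  by rewrite /d2; ring.
Qed.

Lemma proj_rotation c r t th p :
  proj th (frame c r 0 (rotation c t p)) = proj (th - t) (frame c r 0 p).
Proof. by rewrite /proj /frame /rotation /= cos0 sin0 cosB sinB; ring. Qed.

Lemma proj_reflection c r t th p :
  proj th (frame c r 0 (reflection c t p)) = proj (t - th) (frame c r 0 p).
Proof. by rewrite /proj /frame /reflection /= cos0 sin0 cosB sinB; ring. Qed.

Lemma polar_angle (a b : R) : a ^+ 2 + b ^+ 2 = 1 ->
  exists th, a = cos th /\ b = sin th.
Proof.
move=> ab; have a1 : -1 <= a <= 1.
  by rewrite -ler_norml -(@ler_pXn2r _ 2) ?nnegrE // expr1n real_normK ?num_real // -ab lerDl sqr_ge0.
have s : sin (acos a) = `|b|.
  by rewrite sin_acos // -ab addrAC subrr add0r sqrtr_sqr.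
have ca : cos (acos a) = a by rewrite acosK // in_itv.
have [b0|b0] := leP 0 b.
  by exists (acos a); rewrite ca s ger0_norm.
by exists (- acos a); rewrite cosN sinN ca s ltr0_norm // opprK.
Qed.

End Isometries.

Section Tangents.
Variable R : realType.
Local Open Scope classical_set_scope.
Implicit Types (c p q : R * R) (r th : R).

Lemma circleE c r p : 0 < r ->
  circle c r p <-> (frame c r 0 p).1 ^+ 2 + (frame c r 0 p).2 ^+ 2 = 1.
Proof.
move=> r0; have rn : r != 0 by rewrite gt_eqF.
have fc : frame c r 0 c = (0, 0) by rewrite /frame !subrr !mulr0 addr0 subr0 mul0r.
have := edist_frame c 0 p c r0; rewrite fc /circle /= {1}/edist /= !subr0.
set n := _ + _ => e; have n0 : 0 <= n by rewrite addr_ge0 ?sqr_ge0.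
split=> [k|n1]; last first.
  by rewrite -[LHS](mulVKf rn) -e n1 sqrtr1 mulr1.
by rewrite -(sqr_sqrtr n0) e k mulVf // expr1n.
Qed.

(** If the line were not perpendicular to the radius at the common point [p], the
    reflection of [p] in the perpendicular from the center would be a second
    common point. *)
Lemma tangent_line_frame c r L : 0 < r -> tangent_line (circle c r) L ->
  exists th, forall p, proj th (frame c r 0 p) = 1 -> L p.
Proof.
move=> r0 [[x [v [v0 ->]]] [p KLp]]; have rn : r != 0 by rewrite gt_eqF.
have [Kp [t0 _ ep]] : (circle c r `&`
    [set (x.1 + t * v.1, x.2 + t * v.2) | t in [set: R]]) p by rewrite KLp.
have n0 : v.1 ^+ 2 + v.2 ^+ 2 != 0.
  apply: contraNneq v0 => n_eq0; case: v {KLp ep} n_eq0 => v1 v2 /= n_eq0.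
  have := sqr_ge0 v1; have := sqr_ge0 v2 => h2 h1.
  have e1 : v1 ^+ 2 = 0 by lra.
  have e2 : v2 ^+ 2 = 0 by lra.
  by move/eqP: e1; move/eqP: e2; rewrite !sqrf_eq0 => /eqP -> /eqP ->.
set n := _ + _ in n0.
pose w1 := p.1 - c.1; pose w2 := p.2 - c.2.
pose k := 2 * (w1 * v.1 + w2 * v.2) / n.
have Kp' : circle c r (p.1 - k * v.1, p.2 - k * v.2).
  move: Kp; rewrite /circle /edist /= => <-; congr Num.sqrt.
  transitivity (w1 ^+ 2 + w2 ^+ 2 - 2 * k * (w1 * v.1 + w2 * v.2) + k ^+ 2 * n).
    by rewrite /n /w1 /w2; ring.
  rewrite -[RHS]/(w1 ^+ 2 + w2 ^+ 2) /k; by field.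
have : (circle c r `&` [set (x.1 + t * v.1, x.2 + t * v.2) | t in [set: R]])
    (p.1 - k * v.1, p.2 - k * v.2).
  by split => //; exists (t0 - k) => //; rewrite -ep /=; congr (_, _); ring.
rewrite KLp /= => e.
have kv1 : k * v.1 = 0 by have := congr1 fst e => /=; lra.
have kv2 : k * v.2 = 0 by have := congr1 snd e => /=; lra.
have wv : w1 * v.1 + w2 * v.2 = 0.
  have kn : k * n = 0.
    by transitivity (k * v.1 * v.1 + k * v.2 * v.2); [rewrite /n; ring|rewrite kv1 kv2; ring].
  by move: kn; rewrite /k divfK //; lra.
move/(circleE c p r0): Kp => Kp.
have [th [c1 s1]] := polar_angle Kp; exists th => q.
have w1E : w1 = r * cos th.
  by rewrite -c1 /frame /= cos0 sin0 /w1; field.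
have w2E : w2 = r * sin th.
  by rewrite -s1 /frame /= cos0 sin0 /w2; field.
rewrite w1E w2E in wv.
have {}wv : cos th * v.1 + sin th * v.2 = 0.
  by apply: (mulfI rn); rewrite mulr0 -wv; ring.
rewrite /proj /frame /= cos0 sin0 => qL.
pose d1 := q.1 - p.1; pose d2 := q.2 - p.2.
have dw : d1 * cos th + d2 * sin th = 0.
  have cs := cos2Dsin2 th.
  have e1 : (q.1 - c.1) * cos th + (q.2 - c.2) * sin th = r.
    by rewrite -[RHS]mul1r -qL; field.
  have -> : d1 * cos th + d2 * sin th = (q.1 - c.1) * cos th + (q.2 - c.2) * sin th
     - (w1 * cos th + w2 * sin th) by rewrite /d1 /d2 /w1 /w2; ring.
  rewrite e1 w1E w2E.
  have -> : r * cos th * cos th + r * sin th * sin th = r * (cos th ^+ 2 + sin th ^+ 2) by ring.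
  by rewrite cs mulr1 subrr.
have cross : d1 * v.2 - d2 * v.1 = 0.
  rewrite -[LHS]mulr1 -(cos2Dsin2 th).
  transitivity (cos th * (v.2 * (d1 * cos th + d2 * sin th) - d2 * (cos th * v.1 + sin th * v.2))
     + sin th * (d1 * (cos th * v.1 + sin th * v.2) - v.1 * (d1 * cos th + d2 * sin th))).
    by ring.
  by rewrite dw wv; ring.
exists (t0 + (d1 * v.1 + d2 * v.2) / n) => //.
have q1 : x.1 + t0 * v.1 = p.1 by rewrite -ep.
have q2 : x.2 + t0 * v.2 = p.2 by rewrite -ep.
rewrite [RHS]surjective_pairing; congr (_, _); apply: (mulIf n0).
- transitivity ((x.1 + t0 * v.1) * n + (d1 * v.1 + d2 * v.2) * v.1); first by field.
  rewrite q1; transitivity (q.1 * n - v.2 * (d1 * v.2 - d2 * v.1)).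
    by rewrite /d1 /d2 /n; ring.
  by rewrite cross mulr0 subr0.
- transitivity ((x.2 + t0 * v.2) * n + (d1 * v.1 + d2 * v.2) * v.2); first by field.
  rewrite q2; transitivity (q.2 * n + v.1 * (d1 * v.2 - d2 * v.1)).
    by rewrite /d1 /d2 /n; ring.
  by rewrite cross mulr0 addr0.
Qed.

Lemma frame_tangent_line c r th : 0 < r ->
  tangent_line (circle c r) [set p | proj th (frame c r 0 p) = 1].
Proof.
move=> r0; have rn : r != 0 by rewrite gt_eqF.
have cs := cos2Dsin2 th; split.
  exists (homothety c r (cos th, sin th)), (- sin th, cos th); split.
    apply/eqP => -[/eqP s0 /eqP c0]; move: cs.
    by rewrite oppr_eq0 in s0; rewrite (eqP s0) (eqP c0) expr0n addr0 => /eqP; rewrite eq_sym oner_eq0.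
  apply/seteqP; split=> [p|_ [t _ <-]]; rewrite /= /proj /frame /homothety /= cos0 sin0; first move=> e.
    exists ((p.2 - c.2) * cos th - (p.1 - c.1) * sin th) => //.
    have e1 : (p.1 - c.1) * cos th + (p.2 - c.2) * sin th = r.
      by rewrite -[RHS]mul1r -e; field.
    rewrite [RHS]surjective_pairing; congr (_, _).
    - transitivity (c.1 + (p.1 - c.1) * (cos th ^+ 2 + sin th ^+ 2)); last by rewrite cs; ring.
      by rewrite -[in LHS]e1; ring.
    - transitivity (c.2 + (p.2 - c.2) * (cos th ^+ 2 + sin th ^+ 2)); last by rewrite cs; ring.
      by rewrite -[in LHS]e1; ring.
  by rewrite -[RHS]cs; field.
exists (homothety c r (cos th, sin th)); apply/seteqP; split=> [p [Kp Lp]|_ ->].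
  have := rotation_frame c 0 p rn; move/(circleE c p r0): Kp.
  have : proj th (frame c r 0 p) = 1 := Lp.
  case: (frame c r 0 p) => a b; rewrite /proj /= => {}Lp K1 <-.
  have z : (a - cos th) ^+ 2 + (b - sin th) ^+ 2 = 0.
    transitivity (a ^+ 2 + b ^+ 2 + (cos th ^+ 2 + sin th ^+ 2) - 2 * (a * cos th + b * sin th)).
      by ring.
    by rewrite K1 cs Lp; ring.
  have h1 := sqr_ge0 (a - cos th); have h2 := sqr_ge0 (b - sin th).
  have /eqP : (a - cos th) ^+ 2 = 0 by lra.
  have /eqP : (b - sin th) ^+ 2 = 0 by lra.
  rewrite !sqrf_eq0 !subr_eq0 => /eqP -> /eqP ->.
  by rewrite /rotation /homothety /= cos0 sin0; congr (_, _); ring.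
split; last by rewrite /= frame_homothety // /proj /= -!expr2.
by apply/circleE => //; rewrite frame_homothety.
Qed.

End Tangents.

Section UCurve.
Variable R : realType.
Local Open Scope classical_set_scope.
Implicit Types (c : R * R) (r th s t : R).

Lemma u_curveE c r t : u_curve c r t = homothety c r (unit_path t).
Proof.
rewrite /= /unit_path /homothety; case: ifP => _; first by congr (_, _) => /=; ring.
by rewrite (addrC pi t) cosDpi sinDpi; case: ifP => _; congr (_, _) => /=; ring.
Qed.

Lemma unit_path_left t : t <= 0 -> unit_path t = (-1, - t).
Proof. by rewrite /unit_path => ->. Qed.

Lemma unit_path_arc t : 0 <= t <= pi -> unit_path t = (- cos t, - sin t).
Proof.
move=> /andP[t0 tp]; rewrite /unit_path tp; case: ifPn => // t0'.
have -> : t = 0 by apply/eqP; rewrite eq_le t0 t0'.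
by rewrite cos0 sin0.
Qed.

Lemma unit_path_right t : pi <= t -> unit_path t = (1, t - pi).
Proof.
move=> pt; have p0 := @pi_gt0 R; rewrite /unit_path leNgt (lt_le_trans p0 pt) /=.
case: ifPn => // tp; have -> : t = pi by apply/eqP; rewrite eq_le pt tp.
by rewrite cospi sinpi opprK oppr0 subrr.
Qed.

Lemma unit_path_lipschitz s t : edist (unit_path t) (unit_path s) <= `|t - s|.
Proof.
wlog st : s t / s <= t => [H|].
  have [|/ltW/H] := leP s t; first exact: H.
  by rewrite edistC distrC.
have p0 := @pi_gt0 R; rewrite ger0_norm ?subr_ge0 //.
have left (x y : R) : x <= y -> y <= 0 -> edist (unit_path y) (unit_path x) <= y - x.
  move=> xy y0; rewrite (unit_path_left y0) (unit_path_left (le_trans xy y0)).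
  rewrite /edist /= subrr expr0n add0r sqrtr_sqr.
  have -> : - y - - x = - (y - x) by ring.
  by rewrite normrN ger0_norm // subr_ge0.
have right (x y : R) : x <= y -> pi <= x -> edist (unit_path y) (unit_path x) <= y - x.
  move=> xy px; rewrite (unit_path_right px) (unit_path_right (le_trans px xy)).
  rewrite /edist /= subrr expr0n add0r sqrtr_sqr.
  have -> : y - pi - (x - pi) = y - x by ring.
  by rewrite ger0_norm // subr_ge0.
have arc (x y : R) : x <= y -> 0 <= x -> y <= pi -> edist (unit_path y) (unit_path x) <= y - x.
  move=> xy x0 yp.
  have yx0 : 0 <= y - x by rewrite subr_ge0.
  have xi : 0 <= x <= pi by rewrite x0 (le_trans xy).
  have yi : 0 <= y <= pi by rewrite yp (le_trans x0).
  rewrite (unit_path_arc xi) (unit_path_arc yi).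
  rewrite -[X in _ <= X](ger0_norm yx0) -sqrtr_sqr ler_wsqrtr //=.
  have -> : (- cos y - - cos x) ^+ 2 + (- sin y - - sin x) ^+ 2 =
    (cos y ^+ 2 + sin y ^+ 2) + (cos x ^+ 2 + sin x ^+ 2) - 2 * cos (y - x).
    by rewrite cosB; ring.
  by rewrite !cos2Dsin2; have := cos_ge_2 yx0; lra.
have upto0 (x y : R) : x <= y -> y <= pi -> edist (unit_path y) (unit_path x) <= y - x.
  move=> xy yp; have [y0|/ltW y0] := leP y 0; first exact: left.
  have [x0|/ltW x0] := leP 0 x; first exact: arc.
  apply: le_trans (edist_triangle (unit_path 0) _ _) _.
  by have := left x 0 x0 (lexx _); have := arc 0 y y0 (lexx _) yp; lra.
have [tp|/ltW tp] := leP t pi; first exact: upto0.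
have [sp|/ltW sp] := leP pi s; first exact: right.
apply: le_trans (edist_triangle (unit_path pi) _ _) _.
by have := upto0 s pi sp (lexx _); have := right pi t tp (lexx _); lra.
Qed.

Lemma continuous_of_edist (f : R -> R * R) (k : R) : 0 < k ->
  (forall s t, edist (f t) (f s) <= k * `|t - s|) -> continuous f.
Proof.
move=> k0 lip.
have coord (h : R * R -> R) : (forall p q, `|h p - h q| <= edist p q) ->
    continuous (fun t => h (f t)).
  move=> hl t; apply/cvgrPdist_lt => e e0; near=> s.
  apply: le_lt_trans (hl _ _) _; apply: le_lt_trans (lip _ _) _.
  rewrite -ltr_pdivlMl // mulrC.
  by near: s; apply: cvgr_dist_lt; [exact: cvg_id | rewrite divr_gt0].
have h1 (p q : R * R) : `|p.1 - q.1| <= edist p q.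
  by have := ler_proj_edist 0 p q; rewrite projB cos0 sin0 mulr1 mulr0 addr0.
have h2 (p q : R * R) : `|p.2 - q.2| <= edist p q.
  by have := ler_proj_edist (pi / 2) p q; rewrite projB cos_pihalf sin_pihalf mulr1 mulr0 add0r.
have -> : f = fun t => ((f t).1, (f t).2) by apply/funext => t; exact: surjective_pairing.
by move=> t; exact: (cvg_pair (coord fst h1 t) (coord snd h2 t)).
Unshelve. all: by end_near.
Qed.

(** For directions pointing downwards the point of contact of the tangent is on
    the path.  For the others one of the two ends is on the far side of the
    tangent, and the lowest point is on the near side. *)
Lemma unit_path_meets th : exists2 t, -1 <= t <= pi + 1 & proj th (unit_path t) = 1.
Proof.
have p0 := @pi_gt0 R.
have cf : continuous (fun t => proj th (unit_path t)).
  have cu : continuous (@unit_path R).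
    by apply: (@continuous_of_edist _ 1) => // s t; rewrite mul1r unit_path_lipschitz.
  move=> t; apply: cvgD; apply: cvgM; try exact: cvg_cst.
  - by apply: (@cvg_comp _ _ _ _ fst _ _ _ (cu t)); exact: cvg_fst.
  - by apply: (@cvg_comp _ _ _ _ snd _ _ _ (cu t)); exact: cvg_snd.
have [s0|s0] := leP 0 (sin th); last first.
  have ci : -1 <= - cos th <= 1.
    by have := cos_geN1 th; have := cos_le1 th => *; apply/andP; split; lra.
  exists (acos (- cos th)).
    by have := acos_ge0 ci; have := acos_lepi ci => *; apply/andP; split; lra.
  rewrite unit_path_arc ?acos_ge0 ?acos_lepi // acosK ?in_itv // sin_acos // sqrrN opprK.
  by rewrite -sin2cos2 sqrtr_sqr ltr0_norm // opprK /proj /= -!expr2 cos2Dsin2.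
have cs := cos2Dsin2 th.
have f2 : proj th (unit_path (pi / 2)) <= 1.
  rewrite unit_path_arc; last by apply/andP; split; lra.
  by rewrite /proj /= cos_pihalf sin_pihalf; lra.
have [c0|c0] := leP 0 (cos th).
  have f1 : 1 <= proj th (unit_path (pi + 1)).
    rewrite unit_path_right ?lerDl // /proj /= (ltac:(ring) : pi + 1 - pi = 1 :> R) !mul1r.
    by have := mulr_ge0 c0 s0; nra.
  have [|||t] := IVT (f := fun t => proj th (unit_path t)) (a := pi / 2) (b := pi + 1) (v := 1); [lra| | |].
  - exact: continuous_subspaceT.
  - by rewrite ge_min f2 le_max f1 orbT.
  by rewrite in_itv /= => /andP[t1 t2] e; exists t => //; apply/andP; split; lra.
have f1 : 1 <= proj th (unit_path (-1)).
  rewrite unit_path_left ?lerN10 // /proj /= opprK mul1r mulN1r.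
  have c0' : 0 <= - cos th by lra.
  by have := mulr_ge0 c0' s0; nra.
have [|||t] := IVT (f := fun t => proj th (unit_path t)) (a := -1) (b := pi / 2) (v := 1); [lra| | |].
- exact: continuous_subspaceT.
- by rewrite ge_min f2 orbT le_max f1.
by rewrite in_itv /= => /andP[t1 t2] e; exists t => //; apply/andP; split; lra.
Qed.

Variables (c : R * R) (r : R) (sigma : R * R -> R * R).
Hypothesis r0 : 0 < r.
Hypothesis sigma_iso : rotation_or_reflection sigma.
Local Notation h := (transform_curve sigma (u_curve c r)).

Lemma transform_u_curve_lipschitz s t : edist (h t) (h s) <= r * `|t - s|.
Proof.
have -> : edist (h t) (h s) = edist (u_curve c r t) (u_curve c r s).
  by case: sigma_iso => o [a [->|->]] /=; rewrite (edist_rotation, edist_reflection).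
have r0' := ltW r0.
by rewrite !u_curveE edist_homothety // ler_wpM2l // unit_path_lipschitz.
Qed.

Lemma transform_u_curve_bounded : chains_bounded h (lo h) (hi h) (r * (2 + pi)).
Proof.
have := lipschitz_chains_bounded (a := -1) (b := pi + 1) (ltW r0) transform_u_curve_lipschitz.
by have -> : pi + 1 - -1 = 2 + pi :> R by ring.
Qed.

Lemma transform_u_curve_length : (curve_length h <= (r * (2 + pi))%:E)%E.
Proof.
apply/curve_length_leP; last exact: transform_u_curve_bounded.
by rewrite /=; have := @pi_gt0 R; lra.
Qed.

Lemma transform_u_curve_path : plane_path h.
Proof.
split.
- by rewrite /=; have := @pi_gt0 R; lra.
- by apply: continuous_subspaceT; exact: continuous_of_edist transform_u_curve_lipschitz.
- by apply: le_lt_trans transform_u_curve_length _; exact: ltry.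
Qed.

Lemma transform_u_curve_meets : sigma @` circle c r = circle c r ->
  meets_all_tangents (circle c r) h.
Proof.
move=> sK L tL; have [th Lth] := tangent_line_frame r0 tL.
have rn : r != 0 by rewrite gt_eqF.
have [a sE] := isometry_fixes_center r0 sigma_iso sK.
have hE t : h t = sigma (homothety c r (unit_path t)) by rewrite -u_curveE.
case: sE => sE; [have [t tin pt] := unit_path_meets (th - a)
               |have [t tin pt] := unit_path_meets (a - th)];
  exists t; rewrite ?in_itv //; apply: Lth;
  by rewrite hE sE (proj_rotation, proj_reflection) frame_homothety.
Qed.

End UCurve.

(** * Minimal paths *)

Section Main.
Variable R : realType.
Local Open Scope classical_set_scope.
Implicit Types (c : R * R) (r th : R) (g : curve R).

Lemma continuous_frame c r t : continuous (frame c r t).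
Proof.
move=> p; apply: (@cvg_pair _ _ _ _ (nbhs (frame c r t p).1) (nbhs (frame c r t p).2)).
- by apply: cvgM; last exact: cvg_cst; apply: cvgD; apply: cvgM; try exact: cvg_cst;
    apply: cvgB; try exact: cvg_cst; [exact: cvg_fst|exact: cvg_snd].
- by apply: cvgM; last exact: cvg_cst; apply: cvgB; apply: cvgM; try exact: cvg_cst;
    apply: cvgB; try exact: cvg_cst; [exact: cvg_snd|exact: cvg_fst].
Qed.

Lemma within_snd_IVT (G : R -> R * R) (a b s t v : R) : a <= s -> s <= t -> t <= b ->
  {within `[a, b], continuous G} ->
  Num.min (G s).2 (G t).2 <= v <= Num.max (G s).2 (G t).2 ->
  exists2 x, s <= x <= t & (G x).2 = v.
Proof.
move=> as_ st tb cG hv.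
have cy : {within `[s, t], continuous (fun x => (G x).2)}.
  apply: (@continuous_subspaceW _ _ _ `[a, b]).
    by move=> x /=; rewrite !in_itv /= => /andP[sx xt]; rewrite (le_trans as_) // (le_trans xt).
  by move=> x; apply: (@cvg_comp _ _ _ _ snd _ _ _ (cG x)); exact: cvg_snd.
by have [x] := IVT st cy hv; rewrite in_itv /=; exists x.
Qed.

(** Turn the direction given by [three_visits] into the vertical one.  The
    intermediate value theorem makes the heights at the outer visits exactly 1,
    so that they are also known at the ends of the path when the tails are
    trivial. *)
Lemma meeting_path_frame c r g (L : R) : 0 < r -> plane_path g ->
  meets_all_tangents (circle c r) g -> (curve_length g <= (r * L)%:E)%E ->
  exists th, let G := frame c r th \o g in
  [/\ {within `[lo g, hi g], continuous G},
      chains_bounded G (lo g) (hi g) L,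
      forall a, exists2 t, lo g <= t <= hi g & proj a (G t) <= -1 &
      exists t1 t2 t3, [/\ lo g <= t1, t1 <= t2, t2 <= t3 & t3 <= hi g] /\
        [/\ (G t1).2 = 1, (G t2).2 <= -1 & (G t3).2 = 1]].
Proof.
move=> r0 [lohi cg _] meets len.
have cG th : {within `[lo g, hi g], continuous (frame c r th \o g)}.
  by move=> t; apply: (@cvg_comp _ _ _ _ (frame c r th) _ _ _ (cg t)); exact: continuous_frame.
have cov th : exists2 t, lo g <= t <= hi g & 1 <= proj th ((frame c r 0 \o g) t).
  have [t] := meets _ (frame_tangent_line c th r0).
  by rewrite in_itv /= => tab e; exists t; rewrite //= e.
have [th [t1 [t2 [t3 [[at1 t12 t23 t3b] [p1 p2 p3]]]]]] := three_visits lohi (cG 0) cov.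
exists (th - pi / 2) => G.
have projG a t : proj a (G t) = proj (a + (th - pi / 2)) (frame c r 0 (g t)).
  by rewrite /G /= proj_frame.
have snd t : (G t).2 = proj th (frame c r 0 (g t)).
  have := projG (pi / 2) t; rewrite {1}/proj cos_pihalf sin_pihalf mulr0 mulr1 add0r => ->.
  by congr proj; ring.
split; [exact: cG| | |].
- have le := (curve_length_leP _ lohi).1 len.
  have ri : 0 <= r^-1 by rewrite invr_ge0 ltW.
  have := chains_bounded_similar ri (fun p q => edist_frame c (th - pi / 2) p q r0) le.
  by rewrite mulKf // gt_eqF.
- move=> a; have [t tab pt] := cov (a + (th - pi / 2) + pi); exists t => //.
  by rewrite projG; move: pt; rewrite projDpi /=; lra.
have at2 : lo g <= t2 by exact: le_trans t12.
have t2b : t2 <= hi g by exact: le_trans t3b.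
rewrite /= in p1 p2 p3; rewrite -!snd in p1 p2 p3.
have y2 : (G t2).2 <= 1 by lra.
have v12 : Num.min (G t1).2 (G t2).2 <= 1 <= Num.max (G t1).2 (G t2).2.
  by rewrite ge_min le_max p1 y2 orbT.
have v23 : Num.min (G t2).2 (G t3).2 <= 1 <= Num.max (G t2).2 (G t3).2.
  by rewrite ge_min le_max p3 y2 orbT.
have [s1 /andP[ts1 s12] e1] := within_snd_IVT at1 t12 t2b (cG _) v12.
have [s3 /andP[s23 ts3] e3] := within_snd_IVT at2 t23 t3b (cG _) v23.
exists s1, t2, s3; split; split => //.
- exact: le_trans ts1.
- exact: le_trans t3b.
Qed.

Lemma unit_curve_of_minimal_length (G : R -> R * R) (a b : R) : a <= b ->
  {within `[a, b], continuous G} -> chains_bounded G a b (2 + pi) ->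
  (forall th, exists2 t, a <= t <= b & proj th (G t) <= -1) ->
  G a = (-1, 1) -> G b = (1, 1) ->
  exists tau, monotone_change a b (-1) (pi + 1) tau /\
    {in `[a, b]%R, forall t, G t = unit_path (tau t)}.
Proof.
move=> ab cG cb cov Ga Gb.
have vl th s : 0 <= th <= pi -> path <=%R a s -> last a s = b ->
    chain_variation th (G a) (map G s) <= proj th (G a) + proj th (G b) + 2.
  by apply: total_variation_bound => //; rewrite ?Ga ?Gb.
exists (@unit_path_inv R \o G); split.
  have [e1 e2] := extremal_param_ends Ga Gb.
  split; rewrite //=; first exact: extremal_param_continuous vl cG.
  move=> x y; rewrite !in_itv /= => /andP[ax xb] /andP[ay yb] xy.
  exact: extremal_param_nondecreasing vl cov Ga Gb _ _ ax xy yb.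
move=> t; rewrite in_itv /= => tab; exact/esym/(extremal_unit_path vl cov Ga Gb).
Qed.

Lemma rotation_or_reflection_rotation c t : rotation_or_reflection (rotation c t).
Proof. by exists c, t; left. Qed.

Lemma rotation_or_reflection_reflection c t : rotation_or_reflection (reflection c t).
Proof. by exists c, t; right. Qed.

Lemma meeting_path_length c r g : 0 < r -> plane_path g ->
  meets_all_tangents (circle c r) g -> ((r * (2 + pi))%:E <= curve_length g)%E.
Proof.
move=> r0 pg mg; have [L LE] := plane_path_length pg.
have len : (curve_length g <= (r * (r^-1 * L))%:E)%E by rewrite mulVKf ?gt_eqF // LE.
have [th [_ cb cov [t1 [t2 [t3 [[at1 t12 t23 t3b] [y1 y2 y3]]]]]]] :=
  meeting_path_frame r0 pg mg len.
have := arclength_lower_bound cb (conj at1 (lexx t1)) (conj t12 t23) (conj (lexx t3) t3b).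
rewrite y1 y2 y3 lexx => /(_ (And3 isT isT isT) cov); rewrite !edistxx addr0 mul0r addr0.
by rewrite LE lee_fin ler_pdivlMl.
Qed.

(** Since the tails are constant, both ends have height 1.  If the abscissa runs
    from 1 to -1, the path is first reflected in the vertical axis. *)
Lemma minimal_meeting_path c r g : 0 < r -> plane_path g ->
  meets_all_tangents (circle c r) g -> (curve_length g <= (r * (2 + pi))%:E)%E ->
  exists s, [/\ rotation_or_reflection s, s @` circle c r = circle c r &
    same_up_to_reparametrization g (transform_curve s (u_curve c r))].
Proof.
move=> r0 pg mg len; have [lohi _ _] := pg.
have rn : r != 0 by rewrite gt_eqF.
have [th] := meeting_path_frame r0 pg mg len.
set G := frame c r th \o g => -[cG cb cov [t1 [t2 [t3 [[at1 t12 t23 t3b] [y1 y2 y3]]]]]].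
have := arclength_lower_bound cb (conj (lexx _) at1) (conj t12 t23) (conj t3b (lexx _)).
rewrite y1 y2 y3 lexx => /(_ (And3 isT isT isT) cov) tails.
have e1 : edist (G (lo g)) (G t1) = 0.
  by apply/eqP; rewrite eq_le edist_ge0 andbT; have := edist_ge0 (G (hi g)) (G t3); lra.
have e3 : edist (G (hi g)) (G t3) = 0.
  by apply/eqP; rewrite eq_le edist_ge0 andbT; have := edist_ge0 (G (lo g)) (G t1); lra.
have {}y1 : (G (lo g)).2 = 1 by rewrite (edist_eq0 e1).
have {}y3 : (G (hi g)).2 = 1 by rewrite (edist_eq0 e3).
have ge1 (x : R) : x = 1 -> 1 <= x by move=> ->.
have vl := total_variation_bound lohi cb (ge1 _ y1) (ge1 _ y3) cov.
have finish s tau : rotation_or_reflection s -> s @` circle c r = circle c r ->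
    monotone_change (lo g) (hi g) (-1) (pi + 1) tau ->
    {in `[lo g, hi g]%R, forall t, g t = s (homothety c r (unit_path (tau t)))} ->
    exists s, [/\ rotation_or_reflection s, s @` circle c r = circle c r &
    same_up_to_reparametrization g (transform_curve s (u_curve c r))].
  move=> s_iso sK mtau gE; exists s; split => //.
  exists (lo g), (hi g), id, tau; split => //.
    by split => //; apply: continuous_subspaceT => x; exact: cvg_id.
  by move=> t tab; rewrite gE // -u_curveE.
have [[xa xb]|[xa xb]] := extremal_endpoints lohi vl cov.
  have Ga : G (lo g) = (-1, 1) by rewrite [LHS]surjective_pairing xa y1.
  have Gb : G (hi g) = (1, 1) by rewrite [LHS]surjective_pairing xb y3.
  have [tau [mtau GE]] := unit_curve_of_minimal_length lohi cG cb cov Ga Gb.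
  apply: (finish (rotation c th) tau) => //.
  - exact: rotation_or_reflection_rotation.
  - exact: rotation_image_circle.
  by move=> t tab; rewrite -GE // rotation_frame.
pose mirror (p : R * R) := (- p.1, p.2).
have em p q : edist (mirror p) (mirror q) = 1 * edist p q.
  by rewrite mul1r /edist /=; congr Num.sqrt; ring.
have pm a p : proj a (mirror p) = proj (pi - a) p.
  by rewrite /proj /= cosB sinB cospi sinpi; ring.
have cmG : {within `[lo g, hi g], continuous (mirror \o G)}.
  have cm : continuous mirror.
    move=> p; apply: (@cvg_pair _ _ _ _ (nbhs (- p.1)) (nbhs p.2)).
      by apply: cvgN; exact: cvg_fst.
    exact: cvg_snd.
  by move=> t; apply: (@cvg_comp _ _ _ _ mirror _ _ _ (cG t)); exact: cm.
have cbm : chains_bounded (mirror \o G) (lo g) (hi g) (2 + pi).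
  by rewrite -[2 + pi]mul1r; apply: chains_bounded_similar.
have covm a : exists2 t, lo g <= t <= hi g & proj a ((mirror \o G) t) <= -1.
  by have [t tab pt] := cov (pi - a); exists t => //; rewrite /= pm.
have Ga : (mirror \o G) (lo g) = (-1, 1) by rewrite /= /mirror xa y1.
have Gb : (mirror \o G) (hi g) = (1, 1) by rewrite /= /mirror xb y3 opprK.
have [tau [mtau GE]] := unit_curve_of_minimal_length lohi cmG cbm covm Ga Gb.
apply: (finish (reflection c (th + pi)) tau) => //.
- exact: rotation_or_reflection_reflection.
- exact: reflection_image_circle.
move=> t tab; rewrite -GE //= -[LHS](rotation_frame c th _ rn) -/(G t).
rewrite /reflection /rotation /homothety /mirror /= cosDpi sinDpi.
by congr (_, _); ring.
Qed.

End Main.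

Local Open Scope classical_set_scope.
Local Open Scope ring_scope.

Theorem theorem2 (R : realType) (c : R * R) (r : R) (r_gt0 : 0 < r) :
  (exists g : curve R, shortest_path (circle c r) g) /\
  (forall g : curve R, plane_path g ->
     (shortest_path (circle c r) g <->
      exists s : R * R -> R * R,
        [/\ rotation_or_reflection s,
            s @` circle c r = circle c r &
            same_up_to_reparametrization g
              (transform_curve s (u_curve c r))])).
Proof.
have rot := rotation_or_reflection_rotation c (0 : R).
have rotK := rotation_image_circle c r 0.
have shortest g : plane_path g -> meets_all_tangents (circle c r) g ->
    (curve_length g <= (r * (2 + pi))%:E)%E -> shortest_path (circle c r) g.
  move=> pg mg len; split=> // h ph mh.
  exact: le_trans len (meeting_path_length r_gt0 ph mh).
have U_path := transform_u_curve_path c r_gt0 rot.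
have U_meets := transform_u_curve_meets r_gt0 rot rotK.
have U_length := transform_u_curve_length c r_gt0 rot.
split=> [|g pg].
  by exists (transform_curve (rotation c 0) (u_curve c r)); exact: (shortest _ U_path U_meets U_length).
split=> [[_ mg min]|[s [s_iso sK gh]]].
  apply: minimal_meeting_path => //.
  by apply: le_trans U_length; exact: min.
apply: shortest => //.
  exact: reparametrization_meets gh (transform_u_curve_meets r_gt0 s_iso sK).
apply/curve_length_leP; first by case: pg.
apply: reparametrization_chains_bounded gh _.
exact: transform_u_curve_bounded.
Qed.
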